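(* Let $X$ be a Dedekind complete Banach lattice. All band projections on $\mathcal{L}_r(X)$ are inner if and only if $X$ is both atomic and order continuous.
   Context: Banach lattices are real. $\mathcal{L}_+(X)$ is the set of positive (bounded linear) operators on $X$ and $\mathcal{L}_r(X)$ its linear span; for $X$ Dedekind complete, $\mathcal{L}_r(X)$ with the regular norm is a Dedekind complete Banach lattice. A band projection on a Banach lattice $Y$ is a linear map $P\colon Y\to Y$ with $P^2=P$ and $0\le P\le I_Y$; band projections $P_\lambda$ are pairwise disjoint if $P_\lambda P_\mu=0$ for $\lambda\neq\mu$. For a family $\{P_\lambda\}_{\lambda\in\Lambda}$ of pairwise disjoint band projections on $X$ and $\Gamma\subseteq\Lambda\times\Lambda$, $\mathcal{P}_\Gamma\colon\mathcal{L}_r(X)\to\mathcal{L}_r(X)$ is the unique band projection such that $\mathcal{P}_\Gamma(T)=\bigvee_{(\alpha,\beta)\in\Gamma}P_\alpha TP_\beta$ (supremum in $\mathcal{L}_r(X)$, equal to $0$ if $\Gamma=\varnothing$) for all $T\in\mathcal{L}_+(X)$. A band projection $\mathcal{P}$ on $\mathcal{L}_r(X)$ is inner if there exist a family $\{P_\lambda\}_{\lambda\in\Lambda}$ of pairwise disjoint band projections on $X$ and a subset $\Gamma\subseteq\Lambda\times\Lambda$ with $\mathcal{P}=\mathcal{P}_\Gamma$. An atom of $X$ is an element $a>0$ such that $0\le x\le a$ implies $x=\gamma a$ for some $\gamma\in\mathbb{R}_+$; $X$ is atomic if the band generated by its atoms is $X$. *)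

(* Defs.v *)
From HB Require Import structures.
From mathcomp Require Import all_boot all_order all_algebra.
From mathcomp Require Import all_classical all_reals all_analysis.
Set Implicit Arguments.
Unset Strict Implicit.
Unset Printing Implicit Defensive.
Import Order.TTheory GRing.Theory Num.Theory.
Import numFieldNormedType.Exports.
Local Open Scope classical_set_scope.
Local Open Scope ring_scope.

HB.mixin Record isOrderedLmodule (R : numDomainType) V
    of GRing.Lmodule R V & Num.POrderedZmodule V := {
  levD2r : forall z x y : V, x <= y -> x + z <= y + z;
  scalev_ge0 : forall (a : R) (x : V), 0 <= a -> 0 <= x -> 0 <= a *: x
}.

#[short(type="ordLmodType")]
HB.structure Definition OrderedLmodule (R : numDomainType) :=
  {V of GRing.Lmodule R V & Num.POrderedZmodule V & isOrderedLmodule R V}.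

(* The hierarchy has no join of normed modules and orders below numDomainType,
   so the order is added to a complete normed module in a record, whose carrier
   bl_car is then given the normed, lattice and ordLmodType structures. *)
Record banachLatticeType (R : realType) := BanachLattice {
  bl_base : completeNormedModType R;
  bl_le : rel bl_base;
  bl_join : bl_base -> bl_base -> bl_base;
  bl_meet : bl_base -> bl_base -> bl_base;
  bl_le_refl : reflexive bl_le;
  bl_le_anti : antisymmetric bl_le;
  bl_le_trans : transitive bl_le;
  bl_leUx : forall x y z, bl_le (bl_join x y) z = bl_le x z && bl_le y z;
  bl_lexI : forall x y z, bl_le x (bl_meet y z) = bl_le x y && bl_le x z;
  bl_leD2r : forall z x y, bl_le x y -> bl_le (x + z) (y + z);
  bl_scale_ge0 : forall (a : R) x, 0 <= a -> bl_le 0 x -> bl_le 0 (a *: x);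
  bl_norm_le : forall x y,
    bl_le (bl_join x (- x)) (bl_join y (- y)) -> `|x| <= `|y|
}.

Definition bl_car (R : realType) (X : banachLatticeType R) : Type := bl_base X.
Coercion bl_car : banachLatticeType >-> Sortclass.

HB.instance Definition _ (R : realType) (X : banachLatticeType R) :=
  CompleteNormedModule.copy (bl_car X) (bl_base X).

HB.instance Definition _ (R : realType) (X : banachLatticeType R) :=
  Order.Le_isPOrder.Build ring_display (bl_car X)
    (@bl_le_refl R X) (@bl_le_anti R X) (@bl_le_trans R X).

HB.instance Definition _ (R : realType) (X : banachLatticeType R) :=
  Order.POrder_MeetJoin_isLattice.Build ring_display (bl_car X)
    (@bl_lexI R X) (@bl_leUx R X).

HB.instance Definition _ (R : realType) (X : banachLatticeType R) :=
  isOrderedLmodule.Build R (bl_car X) (@bl_leD2r R X) (@bl_scale_ge0 R X).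

(* The modulus |x|, whereas `|x| is the norm of x. *)
Definition modulus (R : realType) (X : banachLatticeType R) (x : X) : X :=
  Order.join x (- x).

Lemma ler_lattice_norm (R : realType) (X : banachLatticeType R) (x y : X) :
  modulus x <= modulus y -> `|x| <= `|y|.
Proof. exact: bl_norm_le. Qed.

Section OrderedLmoduleTheory.
Context {R : numDomainType} {V : ordLmodType R}.
Implicit Types x y z : V.

Lemma subv_ge0 x y : (0 <= y - x) = (x <= y).
Proof.
apply/idP/idP => [/levD2r-/(_ x)|/levD2r-/(_ (- x))].
  by rewrite add0r subrK.
by rewrite subrr.
Qed.

End OrderedLmoduleTheory.

Definition band_projection (R : numDomainType) (Y : ordLmodType R)
    (P : {linear Y -> Y}) : Prop :=
  (forall y, P (P y) = P y) /\ (forall y, 0 <= y -> 0 <= P y /\ P y <= y).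

Record bandProj (R : numDomainType) (Y : ordLmodType R) := BandProj {
  bp_fun :> {linear Y -> Y};
  bpP : band_projection bp_fun
}.

Definition linear_subspace (R : numDomainType) (V : lmodType R) (E : set V) :
    Prop :=
  E 0 /\ (forall (a : R) x y, E x -> E y -> E (a *: x + y)).

Definition linear_span (R : numDomainType) (V : lmodType R) (A : set V) :
  set V := smallest (@linear_subspace R V) A.

Section RegularOperators.
Context {R : realType} (X : banachLatticeType R).

Definition positive_operator (T : X -> X) : Prop :=
  [/\ linear T, continuous T & forall x, 0 <= x -> 0 <= T x].

Definition regular : {pred X -> X} :=
  [pred T | `[< linear_span positive_operator T >]].

Lemma linear_span_subspace (V : lmodType R) (A : set V) :
  linear_subspace (linear_span A).
Proof.
split=> [E [[E0 _] _] //|a x y Ax Ay E EA].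
by have [[_ ED] _] := EA; apply: ED; [exact: Ax|exact: Ay].
Qed.

Lemma regular_submod_closed : submod_closed regular.
Proof.
have [s0 sD] := linear_span_subspace positive_operator.
split; first exact/asboolP.
by move=> a x y /asboolP ? /asboolP ?; apply/asboolP; exact: sD.
Qed.

HB.instance Definition _ :=
  GRing.isSubmodClosed.Build R (X -> X) regular regular_submod_closed.

(* L_r(X) *)
Record Lr := MkLr { Lr_fun :> X -> X; LrP : Lr_fun \in regular }.

HB.instance Definition _ := [isSub for Lr_fun].
HB.instance Definition _ := [Choice of Lr by <:].
HB.instance Definition _ := [SubChoice_isSubLmodule of Lr by <:].

Lemma Lr_linear (T : Lr) : linear T.
Proof.
case: T => T /= /asboolP; apply; split; last by move=> ? [].
split=> [a x y|b S S' linS linS' a x y].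
  by rewrite /= scaler0 addr0.
rewrite !fctE linS linS' !scalerDr !scalerA mulrC -!addrA; congr (_ + _).
by rewrite addrCA.
Qed.

HB.instance Definition _ (T : Lr) :=
  GRing.isLinear.Build R X X *:%R (T : X -> X) (Lr_linear T).

Lemma LrD (S T : Lr) x : (S + T) x = S x + T x. Proof. by []. Qed.
Lemma LrZ a (T : Lr) x : (a *: T) x = a *: T x. Proof. by []. Qed.
Lemma Lr0 x : (0 : Lr) x = 0. Proof. by []. Qed.

Lemma pos_decomp (x : X) : exists u v : X, [/\ 0 <= u, 0 <= v & x = u - v].
Proof.
exists (Order.join x 0), (Order.join x 0 - x); split.
- exact: leUr.
- by rewrite subv_ge0 leUl.
- by rewrite opprB addrC subrK.
Qed.

Lemma Lr_pos_eq (S T : Lr) : (forall x, 0 <= x -> S x = T x) -> S = T.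
Proof.
move=> ST; apply: val_inj; apply/funext => x /=.
by have [u [v [u0 v0 ->]]] := pos_decomp x; rewrite !linearB /= !ST.
Qed.

Definition Lr_le (S T : Lr) : bool := `[< forall x, 0 <= x -> S x <= T x >].

Lemma Lr_le_refl : reflexive Lr_le.
Proof. by move=> T; apply/asboolP. Qed.

Lemma Lr_le_anti : antisymmetric Lr_le.
Proof.
move=> S T /andP[/asboolP ST /asboolP TS]; apply: Lr_pos_eq => x x0.
by apply: le_anti; rewrite ST// TS.
Qed.

Lemma Lr_le_trans : transitive Lr_le.
Proof.
move=> T S U /asboolP ST /asboolP TU; apply/asboolP => x x0.
exact: le_trans (ST _ x0) (TU _ x0).
Qed.

HB.instance Definition _ := Order.Le_isPOrder.Build ring_display Lr
  Lr_le_refl Lr_le_anti Lr_le_trans.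

Lemma Lr_leP (S T : Lr) : reflect (forall x, 0 <= x -> S x <= T x) (S <= T).
Proof. exact: asboolP. Qed.

Lemma Lr_leD2r (U S T : Lr) : S <= T -> S + U <= T + U.
Proof.
by move=> /Lr_leP ST; apply/Lr_leP => x x0; rewrite !LrD levD2r// ST.
Qed.

Lemma Lr_scale_ge0 (a : R) (T : Lr) : 0 <= a -> 0 <= T -> 0 <= a *: T.
Proof.
move=> a0 /Lr_leP T0; apply/Lr_leP => x x0.
by rewrite LrZ scalev_ge0// T0.
Qed.

HB.instance Definition _ :=
  isOrderedLmodule.Build R Lr Lr_leD2r Lr_scale_ge0.

Lemma bp_norm_le (P : bandProj X) (x : X) : `|P x| <= `|x|.
Proof.
have [_ P0] := bpP P; apply: ler_lattice_norm.
set m := Order.join x (- x).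
have xm : x <= m by exact: leUl.
have nxm : - x <= m by exact: leUr.
have mono (y z : X) : y <= z -> P y <= P z.
  rewrite -subv_ge0 => /P0[+ _]; by rewrite linearB subv_ge0.
have m0 : 0 <= m.
  have := levD2r (- x) _ _ xm; rewrite subrr => h1.
  have h2 : 0 <= m + m.
    by apply: le_trans h1 _; rewrite addrC (addrC m) levD2r.
  have := @scalev_ge0 _ _ (2^-1 : R) _ _ h2; rewrite invr_ge0 ler0n => /(_ isT).
  by rewrite -(mulr2n m) -(scaler_nat 2 m) scalerA mulVf ?pnatr_eq0// scale1r.
have [_ Pm] := P0 _ m0.
rewrite leUx (le_trans (mono _ _ xm) Pm) /= -linearN.
exact: le_trans (mono _ _ nxm) Pm.
Qed.

Lemma bp_continuous (P : bandProj X) : continuous P.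
Proof.
apply: bounded_linear_continuous; apply/linear_boundedP; near=> r => x.
have r1 : 1 <= r by near: r; exact: nbhs_pinfty_ge.
by apply: le_trans (bp_norm_le P x) _; rewrite ler_peMl.
Unshelve. all: by end_near. Qed.

Lemma sandwich_regular (P Q : bandProj X) (T : Lr) :
  (P : X -> X) \o T \o Q \in regular.
Proof.
have [sp0 spD] := linear_span_subspace positive_operator.
case: T => T /= /asboolP Treg; apply/asboolP.
apply: (Treg [set S | linear_span positive_operator (P \o S \o Q)]).
split; last first.
  move=> S [linS contS S0] E [_]; apply; split=> [a x y||x x0] /=.
  - by rewrite linearP linS linearP.
  - move=> x; apply: (@continuous_comp _ _ _ Q (P \o S)).
      exact: bp_continuous.
    by apply: continuous_comp; [exact: contS|exact: bp_continuous].
  - by have [[_ +] [_ +]] := (bpP P, bpP Q) => /(_ _ _)/proj1 h;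
      move=> /(_ _ x0)[+ _] => /S0/h.
split=> [|a S S' hS hS'] /=.
  by rewrite (_ : _ \o _ = 0)//; apply/funext => x /=; rewrite linear0.
rewrite (_ : _ \o _ = a *: (P \o S \o Q) + (P \o S' \o Q)); first exact: spD.
by apply/funext => x /=; rewrite !fctE linearP.
Qed.

(* P T Q *)
Definition sandwich (P Q : bandProj X) (T : Lr) : Lr :=
  MkLr (sandwich_regular P Q T).

Definition pairwise_disjoint (L : Type) (P : L -> bandProj X) : Prop :=
  forall l m, l <> m -> forall x, P l (P m x) = 0.

(* PP is P_Gamma; it is determined by its values on L_+(X), see
   PGamma_unique. The case split is needed since the empty set has no
   supremum in L_r(X) when X is nonzero. *)
Definition is_PGamma (L : Type) (P : L -> bandProj X) (G : set (L * L))
    (PP : bandProj Lr) : Prop :=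
  forall T : Lr, 0 <= T ->
    (G = set0 -> PP T = 0) /\
    (G !=set0 ->
       supremums [set sandwich (P ab.1) (P ab.2) T | ab in G] (PP T)).

Lemma PGamma_unique (L : Type) (P : L -> bandProj X) (G : set (L * L))
    (PP QQ : bandProj Lr) :
  is_PGamma P G PP -> is_PGamma P G QQ -> PP =1 QQ.
Proof.
move=> hP hQ.
have eq_pos (T : Lr) : 0 <= T -> PP T = QQ T.
  move=> T0; have [[P0 P1] [Q0 Q1]] := (hP T T0, hQ T T0).
  have [G0|G0] := pselect (G = set0); first by rewrite P0// Q0.
  have {}G0 : G !=set0 by exact/set0P/eqP.
  exact: (is_subset1_supremums (P1 G0) (Q1 G0)).
move=> T.
suff [E TE] : exists T' : Lr, (T' : X -> X) = T /\ PP T' = QQ T'.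
  by rewrite (_ : T = E) ?TE.2//; apply: val_inj; rewrite /= TE.1.
have /asboolP := LrP T.
apply: (_ : _ `<=` [set S : X -> X | exists T' : Lr, (T' : X -> X) = S /\
  PP T' = QQ T']).
apply: smallest_sub; first split.
- by exists 0; rewrite !linear0.
- move=> a _ _ [S [<- hS]] [S' [<- hS']]; exists (a *: S + S'); split => //.
  by rewrite !linearP hS hS'.
move=> S Spos.
have Sreg : S \in regular by apply/asboolP; exact: sub_gen_smallest.
exists (MkLr Sreg); split=> //; apply: eq_pos; apply/Lr_leP => x x0.
by case: Spos => _ _; exact.
Qed.

Definition inner (PP : bandProj Lr) : Prop :=
  exists (L : Type) (P : L -> bandProj X) (G : set (L * L)),
    pairwise_disjoint P /\ is_PGamma P G PP.

Definition dedekind_complete : Prop :=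
  forall A : set X, has_sup A -> supremums A !=set0.

Definition atom (a : X) : Prop :=
  0 < a /\
  (forall x, 0 <= x -> x <= a -> exists2 c : R, 0 <= c & x = c *: a).

Definition band (B : set X) : Prop :=
  [/\ linear_subspace B,
      forall x y, B y -> modulus x <= modulus y -> B x
    & forall (A : set X) (s : X), A `<=` B -> supremums A s -> B s].

Definition atomic : Prop := smallest band [set a | atom a] = setT.

(* x_i \downarrow 0 implies ||x_i|| -> 0, for all nets (x_i) in X *)
Definition order_continuous : Prop :=
  forall (I : Type) (leI : I -> I -> Prop) (x : I -> X),
    inhabited I ->
    (forall i, leI i i) ->
    (forall i j k, leI i j -> leI j k -> leI i k) ->
    (forall i j, exists k, leI i k /\ leI j k) ->
    (forall i j, leI i j -> x j <= x i) ->
    infimums (range x) 0 ->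
    forall e : R, 0 < e -> exists i, forall j, leI i j -> `|x j| < e.

End RegularOperators.

(* Main.v *)
(** If [X] is atomic and order continuous, the blocks [P_a T P_b] of the atom
projections are multiples of a single operator, so a band projection either
fixes or kills each of them; order continuity makes a positive operator
determined by its blocks.

Conversely, a family of band projections on [L_r(X)] has an infimum. The
projection onto [{T | (I - Q) T Q = 0 for all Q}] fixes [I] and forces [X] to be
atomic if it is inner. If [X] is atomic but not order continuous, Hahn-Banach
yields a nonzero positive functional vanishing on all atoms, and the projection
onto [{T | T a = 0 for all atoms a}] cannot be inner, because every nonzero band
of [X] contains an atom. *)

Require Import Defs.
From HB Require Import structures.
From mathcomp Require Import all_boot all_order all_algebra.
From mathcomp Require Import all_classical all_reals all_analysis.
From mathcomp Require Import lra.
Set Implicit Arguments.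
Unset Strict Implicit.
Unset Printing Implicit Defensive.
Import Order.TTheory GRing.Theory Num.Theory.
Import numFieldNormedType.Exports.
Local Open Scope classical_set_scope.
Local Open Scope ring_scope.

(** [Lr X] carries an order here but no lattice operations. What replaces them is that its positive
    cone generates and that a downward directed family of positive operators has an infimum,
    computed pointwise on the cone of [X]. Band projections are therefore built on the cone and
    extended linearly. The converse rests on inner projections acting on blocks wholesale: once
    [(a, b)] lies in [G], [P_a T P_b <= PP T] holds for every [T >= 0]. Rank one operators can be
    fitted into such a block and need not obey the equations defining the range of [PP]. The
    identity, respectively a rank one operator vanishing on the atoms, only certifies that a
    suitable block is present. *)

Lemma cross_eq (V : zmodType) (x y a b : V) :
  (x - y == a - b) = (x + b == a + y).
Proof. by rewrite subr_eq addrAC eq_sym subr_eq eq_sym. Qed.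

(** * Ordered modules and band projections *)

Section OrderedModule.
Context {R : realType} {V : ordLmodType R}.
Implicit Types (x y z : V) (c : R).

Lemma levD x y z (t : V) : x <= y -> z <= t -> x + z <= y + t.
Proof.
move=> xy zt; apply: (le_trans (levD2r z _ _ xy)).
by rewrite ![y + _]addrC; exact: levD2r.
Qed.

Lemma levN2 x y : (- x <= - y) = (y <= x).
Proof. by rewrite -[LHS]subv_ge0 opprK addrC subv_ge0. Qed.

Lemma levBlDr x y z : (x - y <= z) = (x <= z + y).
Proof. by rewrite -[LHS]subv_ge0 opprB addrA subv_ge0. Qed.

Lemma levBrDr x y z : (x <= y - z) = (x + z <= y).
Proof. by rewrite -[LHS]subv_ge0 -addrA -opprD subv_ge0 addrC. Qed.

Lemma addv_ge0 x y : 0 <= x -> 0 <= y -> 0 <= x + y.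
Proof. by move=> x0 y0; rewrite -[0]addr0; exact: levD. Qed.

Lemma lev_wpDr x y : 0 <= y -> x <= x + y.
Proof. by move=> y0; rewrite -{1}[x]addr0; exact: levD. Qed.

Lemma gev_wBr x y : 0 <= y -> x - y <= x.
Proof. by move=> y0; rewrite levBlDr lev_wpDr. Qed.

Lemma gev_wDr x y : y <= 0 -> x + y <= x.
Proof. by move=> y0; rewrite -[leRHS]addr0 levD. Qed.

Lemma levB2l x y z : (x - y <= x - z) = (z <= y).
Proof. by rewrite -[LHS]subv_ge0 opprB addrC addrA subrK subv_ge0. Qed.

Lemma lev_scale c x y : 0 <= c -> x <= y -> c *: x <= c *: y.
Proof.
rewrite -[x <= y]subv_ge0 -[_ <= c *: y]subv_ge0 -scalerBr; exact: scalev_ge0.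
Qed.

Lemma lev_pscale c x y : 0 < c -> (c *: x <= c *: y) = (x <= y).
Proof.
move=> c0; apply/idP/idP => [|]; last exact/lev_scale/ltW.
have ci : 0 <= c^-1 by rewrite invr_ge0 ltW.
by move/(lev_scale ci); rewrite !scalerA mulVf ?gt_eqF// !scale1r.
Qed.

Definition is_inf (I : Type) (u : I -> V) (m : V) :=
  (forall i, m <= u i) /\ (forall w, (forall i, w <= u i) -> w <= m).

Lemma is_inf_unique (I : Type) (u : I -> V) m n :
  is_inf u m -> is_inf u n -> m = n.
Proof.
by move=> [m1 m2] [n1 n2]; apply: le_anti; rewrite n2//= m2.
Qed.

(** The hypothesis is joint directedness: one index [k] serves both families, so a lower bound [w]
    of the diagonal sums satisfies [w <= u i + v j] for independent [i] and [j]. *)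
Lemma is_infD (I : Type) (u v : I -> V) m n :
  (forall i j, exists k, u k <= u i /\ v k <= v j) ->
  is_inf u m -> is_inf v n -> is_inf (fun i => u i + v i) (m + n).
Proof.
move=> D [m1 m2] [n1 n2]; split=> [i|w wuv]; first exact: levD.
have wu j : w - v j <= m.
  apply: m2 => i; have [k [ki kj]] := D i j; rewrite levBlDr.
  exact: le_trans (wuv k) (levD ki kj).
by rewrite addrC -levBlDr; apply: n2 => j; rewrite levBlDr addrC -levBlDr.
Qed.

Lemma is_infZ (I : Type) (u : I -> V) m c :
  0 < c -> is_inf u m -> is_inf (fun i => c *: u i) (c *: m).
Proof.
move=> c0 [m1 m2]; split=> [i|w wu]; first by rewrite lev_pscale.
have cK : w = c *: (c^-1 *: w) by rewrite scalerA divff ?gt_eqF// scale1r.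
rewrite cK lev_pscale//; apply: m2 => i; by rewrite -(lev_pscale _ _ c0) -cK.
Qed.

Definition generating_cone :=
  forall y, exists u v : V, [/\ 0 <= u, 0 <= v & y = u - v].

Lemma eq_on_cone (W : lmodType R) (f g : {linear V -> W}) : generating_cone ->
  (forall y, 0 <= y -> f y = g y) -> f =1 g.
Proof.
by move=> gen fg y; have [u [v [u0 v0 ->]]] := gen y; rewrite !linearB/= !fg.
Qed.

(** Kantorovich extension: additivity makes the difference of the values of [f] on the two parts of
    [y] independent of the decomposition chosen. *)
Lemma cone_extend (W : lmodType R) (f : V -> W) : generating_cone ->
  (forall x y, 0 <= x -> 0 <= y -> f (x + y) = f x + f y) ->
  (forall c x, 0 < c -> 0 <= x -> f (c *: x) = c *: f x) ->
  exists g : {linear V -> W}, forall x, 0 <= x -> g x = f x.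
Proof.
move=> gen fD fZ.
pose u y := sval (cid (gen y)).
pose v y := sval (cid (svalP (cid (gen y)))).
have uv y : [/\ 0 <= u y, 0 <= v y & y = u y - v y].
  exact: (svalP (cid (svalP (cid (gen y))))).
have gE z x y : 0 <= x -> 0 <= y -> z = x - y -> f (u z) - f (v z) = f x - f y.
  move=> x0 y0 zxy; have [u0 v0 e] := uv z.
  have : f (x + v z) = f (u z + y).
    by congr f; apply/eqP; rewrite -cross_eq -e zxy.
  by rewrite !fD// => /eqP; rewrite -cross_eq => /eqP ->.
have linf : linear (fun y => f (u y) - f (v y)).
  move=> c x y; have [[ux vx ex] [uy vy ey]] := (uv x, uv y).
  have [c0|c0|->] := ltgtP c 0; last by rewrite !scale0r !add0r.
  (* A negative scalar exchanges the positive and negative parts of [x]. *)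
  - have nc : 0 < - c by rewrite oppr_gt0.
    rewrite (gE _ ((- c) *: v x + u y) ((- c) *: u x + v y)).
    + rewrite (fD _ _ (scalev_ge0 _ _ (ltW nc) vx) uy).
      rewrite (fD _ _ (scalev_ge0 _ _ (ltW nc) ux) vy).
      rewrite !fZ// scalerBr opprD addrACA.
      by rewrite !scaleNr opprK [- _ + _]addrC.
    + by rewrite addv_ge0// (scalev_ge0 _ _ (ltW nc)).
    + by rewrite addv_ge0// (scalev_ge0 _ _ (ltW nc)).
    + rewrite {1}ex {1}ey scalerBr opprD addrACA !scaleNr opprK.
      by rewrite addrACA [RHS]addrACA [_ + c *: u x]addrC.
  - rewrite (gE _ (c *: u x + u y) (c *: v x + v y)).
    + rewrite (fD _ _ (scalev_ge0 _ _ (ltW c0) ux) uy).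
      rewrite (fD _ _ (scalev_ge0 _ _ (ltW c0) vx) vy).
      by rewrite !fZ// scalerBr opprD addrACA.
    + by rewrite addv_ge0// (scalev_ge0 _ _ (ltW c0)).
    + by rewrite addv_ge0// (scalev_ge0 _ _ (ltW c0)).
    + by rewrite {1}ex {1}ey scalerBr opprD addrACA.
pose H := GRing.isLinear.Build R V W *:%R _ linf.
pose g : {linear V -> W} := HB.pack (fun y => f (u y) - f (v y)) H.
exists g => x x0 /=.
have f0 : f 0 = 0 by apply: (@addIr _ (f 0)); rewrite -fD// addr0 add0r.
by rewrite (gE _ x 0) ?subr0// f0 subr0.
Qed.

Lemma bandProj_extend (f : V -> V) : generating_cone ->
  (forall x y, 0 <= x -> 0 <= y -> f (x + y) = f x + f y) ->
  (forall c x, 0 < c -> 0 <= x -> f (c *: x) = c *: f x) ->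
  (forall x, 0 <= x -> [/\ 0 <= f x, f x <= x & f (f x) = f x]) ->
  exists P : bandProj V, forall x, 0 <= x -> P x = f x.
Proof.
move=> gen fD fZ fP; have [g gf] := cone_extend gen fD fZ.
have gP : band_projection g.
  split=> [y|y y0]; last by rewrite gf//; have [] := fP _ y0.
  pose gg : {linear V -> V} := g \o g.
  apply: (eq_on_cone (f := gg) gen) => {}y y0 /=.
  by rewrite !gf//; have [] := fP _ y0.
by exists (BandProj gP).
Qed.

Lemma bp_idem (P : bandProj V) y : P (P y) = P y.
Proof. by have [] := bpP P. Qed.

Lemma bp_ge0 (P : bandProj V) y : 0 <= y -> 0 <= P y.
Proof. by have [_ h] := bpP P => /h[]. Qed.

Lemma bp_le (P : bandProj V) y : 0 <= y -> P y <= y.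
Proof. by have [_ h] := bpP P => /h[]. Qed.

Lemma bp_mono (P : bandProj V) x y : x <= y -> P x <= P y.
Proof. by rewrite -subv_ge0 => /(bp_ge0 P); rewrite linearB subv_ge0. Qed.

Lemma compl_band_projection (P : bandProj V) : band_projection (idfun \- P).
Proof.
split=> [y|y y0] /=; first by rewrite linearB /= bp_idem subrr subr0.
by rewrite subv_ge0 bp_le// gev_wBr// bp_ge0.
Qed.

Definition bp_compl (P : bandProj V) : bandProj V :=
  BandProj (compl_band_projection P).

Lemma id_band_projection : band_projection (@idfun V).
Proof. by split. Qed.

Definition bp_id : bandProj V := BandProj id_band_projection.

(** The complementary projection is monotone and kills [y], hence also [x]. *)
Lemma bp_id_on (P : bandProj V) x y : 0 <= x -> x <= y -> P y = y -> P x = x.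
Proof.
move=> x0 xy Py; apply/eqP; rewrite eq_sym -subr_eq0; apply/eqP/le_anti.
have := bp_mono (bp_compl P) xy; rewrite /= Py subrr => ->/=.
exact: (bp_ge0 (bp_compl P)).
Qed.

Lemma bp_kills (P : bandProj V) x y : 0 <= x -> x <= y -> P y = 0 -> P x = 0.
Proof.
by move=> x0 xy Py; apply: le_anti; rewrite bp_ge0// -{1}Py bp_mono.
Qed.

(* [P (I - Q)] takes values below the range of [I - Q], so [Q] kills it. *)
Lemma bp_comm (P Q : bandProj V) : generating_cone ->
  forall y, P (Q y) = Q (P y).
Proof.
move=> gen; pose f : {linear V -> V} := P \o Q.
pose g : {linear V -> V} := Q \o P.
have half (S T : bandProj V) z : 0 <= z -> T (S (T z)) = S (T z).
  move=> z0; apply: (bp_id_on (y := T z)); rewrite ?bp_idem ?bp_ge0//.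
  by rewrite bp_le// bp_ge0.
apply: (eq_on_cone (f := f) (g := g) gen) => y y0 /=.
have w0 : 0 <= y - Q y := bp_ge0 (bp_compl Q) y0.
have : Q (P (y - Q y)) = 0.
  apply: (bp_kills (y := y - Q y)); rewrite ?bp_ge0 ?bp_le//.
  by rewrite linearB/= bp_idem subrr.
by rewrite !linearB /= half// => /eqP; rewrite subr_eq0 => /eqP.
Qed.

Lemma comp_band_projection (P Q : bandProj V) : generating_cone ->
  band_projection (P \o Q).
Proof.
move=> gen; split=> [y|y y0] /=.
  by rewrite -(bp_comm P Q gen (Q y)) bp_idem bp_idem.
rewrite bp_ge0 ?bp_ge0//; split=> //.
exact: le_trans (bp_le _ (bp_ge0 _ y0)) (bp_le _ y0).
Qed.

Fixpoint bp_comp (I : Type) (P : I -> bandProj V) (s : seq I) : V -> V :=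
  if s is i :: s' then P i \o bp_comp P s' else idfun.

Section BandProjInfimum.
Context (I : Type) (P : I -> bandProj V) (gen : generating_cone).
Implicit Types s t : seq I.

Lemma bp_comp_ex s : exists Q : bandProj V, Q =1 bp_comp P s.
Proof.
elim: s => [|i s [Q QE]]; first by exists bp_id.
by exists (BandProj (comp_band_projection (P i) Q gen)) => y /=; rewrite QE.
Qed.

Lemma bp_comp_cat s t y : bp_comp P (s ++ t) y = bp_comp P s (bp_comp P t y).
Proof. by elim: s => //= i s ->. Qed.

Lemma bp_comp_catl s t y : 0 <= y -> bp_comp P (s ++ t) y <= bp_comp P t y.
Proof.
move=> y0; rewrite bp_comp_cat; have [Q QE] := bp_comp_ex s.
by rewrite -QE bp_le//; have [Q' <-] := bp_comp_ex t; exact: bp_ge0.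
Qed.

Lemma bp_comp_catr s t y : 0 <= y -> bp_comp P (s ++ t) y <= bp_comp P s y.
Proof.
move=> y0; rewrite bp_comp_cat; have [Q QE] := bp_comp_ex s.
have [Q' QE'] := bp_comp_ex t.
by rewrite -!QE -QE' bp_mono// bp_le.
Qed.

Lemma bp_comp_fix s y : (forall i, P i y = y) -> bp_comp P s y = y.
Proof. by move=> Py; elim: s => //= i s ->. Qed.

(* [Q y] is the infimum of [P i1 (... (P ik y))] over all finite lists. *)
Lemma bp_inf : (forall u : seq I -> V, (forall s, 0 <= u s) ->
    (forall s t : seq I, exists r, u r <= u s /\ u r <= u t) ->
    exists m, is_inf u m) ->
  exists Q : bandProj V, (forall i y, P i (Q y) = Q y) /\
    (forall y, 0 <= y -> (forall i, P i y = y) -> Q y = y).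
Proof.
move=> infV.
have c0 s y : 0 <= y -> 0 <= bp_comp P s y.
  by move=> y0; have [Q <-] := bp_comp_ex s; exact: bp_ge0.
have ex y : exists m, 0 <= y -> is_inf (fun s => bp_comp P s y) m.
  have [y0|ny0] := boolP (0 <= y); last by exists 0.
  have [s|s t|m hm] := infV (fun s => bp_comp P s y); last by exists m.
    exact: c0.
  by exists (s ++ t); rewrite bp_comp_catl// bp_comp_catr.
have [f fP] := choice ex.
have f0 y : 0 <= y -> 0 <= f y.
  by move=> y0; apply: (fP _ y0).2 => s; exact: c0.
have fle s y : 0 <= y -> f y <= bp_comp P s y by move=> /fP[].
(* The one-element list puts [f y] below [P i y], an element fixed by [P i]. *)
have Pf i y : 0 <= y -> P i (f y) = f y.
  move=> y0; apply: (bp_id_on (y := P i y)); rewrite ?bp_idem// ?f0//.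
  exact: (fle [:: i]).
have fixf y : 0 <= y -> (forall i, P i y = y) -> f y = y.
  move=> y0 Py; apply: is_inf_unique (fP _ y0) _.
  by split=> [s|w]; [|move=> /(_ [::])]; rewrite bp_comp_fix.
have [|||Q Qf] := @bandProj_extend f gen.
- move=> x y x0 y0; apply: is_inf_unique (fP _ (addv_ge0 x0 y0)) _.
  rewrite (_ : (fun _ => _) = (fun s => bp_comp P s x + bp_comp P s y)).
    apply: is_infD; [|exact: fP|exact: fP] => s t; exists (s ++ t).
    by rewrite bp_comp_catl// bp_comp_catr.
  by apply/funext => s; have [Q QE] := bp_comp_ex s; rewrite -!QE linearD.
- move=> c x c0' x0.
  apply: is_inf_unique (fP _ (scalev_ge0 _ _ (ltW c0') x0)) _.
  rewrite (_ : (fun _ => _) = (fun s => c *: bp_comp P s x)).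
    by apply: is_infZ => //; exact: fP.
  by apply/funext => s; have [Q QE] := bp_comp_ex s; rewrite -!QE linearZ.
- move=> x x0; split; [exact: f0|exact: (fle [::])|].
  by apply: fixf => [|i]; [exact: f0|exact: Pf].
exists Q; split=> [i y|y y0 Py]; last by rewrite Qf// fixf.
pose PQ : {linear V -> V} := P i \o Q.
by apply: (eq_on_cone (f := PQ) gen) => {}y y0 /=; rewrite Qf// Pf.
Qed.

End BandProjInfimum.

End OrderedModule.

Arguments generating_cone {R} V.
Arguments bp_id {R V}.

(** * Banach lattices *)

Section BanachLattice.
Context {R : realType} {X : banachLatticeType R}.
Implicit Types (x y z w : X) (c : R).

Definition posv x : X := Order.join x 0.

Lemma posv_le x z : (posv x <= z) = (x <= z) && (0 <= z).
Proof. exact: leUx. Qed.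

Lemma posv_ge0 x : 0 <= posv x. Proof. exact: leUr. Qed.

Lemma le_posv x : x <= posv x. Proof. exact: leUl. Qed.

Lemma posv_id x : 0 <= x -> posv x = x.
Proof. by move=> x0; apply: le_anti; rewrite le_posv posv_le lexx x0. Qed.

Lemma posv_mono x y : x <= y -> posv x <= posv y.
Proof. by move=> xy; rewrite posv_le posv_ge0 (le_trans xy (le_posv y)). Qed.

Lemma posvZ c x : 0 < c -> posv (c *: x) = c *: posv x.
Proof.
move=> c0; have ci : 0 < c^-1 by rewrite invr_gt0.
have cK y : y = c *: (c^-1 *: y) by rewrite scalerA divff ?gt_eqF// scale1r.
have c0' := ltW c0; apply: le_anti; apply/andP; split.
  by rewrite posv_le lev_pscale// le_posv scalev_ge0 ?posv_ge0.
rewrite [posv (c *: x)]cK lev_pscale// posv_le; apply/andP; split.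
  by rewrite -(lev_pscale _ _ c0) -cK le_posv.
by rewrite scalev_ge0 ?posv_ge0// ltW.
Qed.

Lemma posvD x y : posv (x + y) <= posv x + posv y.
Proof. by rewrite posv_le levD ?le_posv// addv_ge0 ?posv_ge0. Qed.

Lemma vl_generating : generating_cone X.
Proof. exact: pos_decomp. Qed.

Lemma modulus_id x : 0 <= x -> modulus x = x.
Proof.
move=> x0; apply: le_anti; rewrite leUl leUx lexx /=.
by rewrite (le_trans _ x0)// -[X in _ <= X]oppr0 levN2.
Qed.

Lemma modulus_ge0 x : 0 <= modulus x.
Proof.
rewrite -(@lev_pscale _ _ 2%:R)// scaler0 scaler_nat mulr2n -(subrr x).
by rewrite levD ?leUl ?leUr.
Qed.

Lemma norm_mono x y : 0 <= x -> x <= y -> `|x| <= `|y|.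
Proof.
move=> x0 xy; apply: ler_lattice_norm.
by rewrite !modulus_id// (le_trans x0).
Qed.

Lemma norm_modulus x : `|modulus x| = `|x|.
Proof.
have h := modulus_id (modulus_ge0 x).
by apply/le_anti/andP; split; apply: ler_lattice_norm; rewrite h.
Qed.

Lemma norm_dominated x y : - y <= x -> x <= y -> `|x| <= `|y|.
Proof.
move=> nyx xy; apply: ler_lattice_norm.
rewrite leUx (le_trans xy) ?leUl//=.
by rewrite -levN2 opprK (le_trans _ nyx)// levN2 leUl.
Qed.

Lemma norm_posv x : `|posv x| <= `|x|.
Proof.
rewrite -[`|x|]norm_modulus norm_mono ?posv_ge0//.
by rewrite posv_le modulus_ge0 leUl.
Qed.

Lemma posv_eq0 x : x <= 0 -> posv x = 0.
Proof. by move=> x0; apply: le_anti; rewrite posv_ge0 posv_le x0 lexx. Qed.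

(** For [y >= 0] the negative part of [x] is at most [posv (y - x)], so its norm is bounded by the
    distance from [x] to [y]. *)
Lemma cone_closed x :
  (forall e : R, 0 < e -> exists2 y, 0 <= y & `|y - x| < e) -> 0 <= x.
Proof.
move=> h; suff : posv (- x) = 0.
  by move=> p0; rewrite -levN2 oppr0 -p0 le_posv.
apply/eqP; rewrite -normr_le0; apply/ler_addgt0Pl => e e0; rewrite addr0.
have [y y0 /ltW yx] := h e e0; apply: le_trans yx.
apply: le_trans (norm_posv _); apply: norm_mono; rewrite ?posv_ge0//.
by apply: posv_mono; rewrite addrC lev_wpDr.
Qed.

Lemma vl_archimedean x y z :
  (forall e : R, 0 < e -> x <= y + e *: z) -> x <= y.
Proof.
move=> h; rewrite -subv_ge0; apply: cone_closed => e e0.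
have d0 : 0 < e / (`|z| + 1) by rewrite divr_gt0// ltr_wpDl.
exists (y + (e / (`|z| + 1)) *: z - x); first by rewrite subv_ge0 h.
rewrite opprB addrA subrK addrAC subrr add0r normrZ gtr0_norm// mulrAC.
by rewrite ltr_pdivrMr ?ltr_wpDl// ltr_pM2l// ltrDl.
Qed.

Lemma pos_linear_mono (f : {linear X -> X}) x y :
  (forall x, 0 <= x -> 0 <= f x) -> x <= y -> f x <= f y.
Proof. by move=> f0; rewrite -subv_ge0 => /f0; rewrite linearB subv_ge0. Qed.

Lemma pos_linear_norm (f : {linear X -> X}) x :
  (forall x, 0 <= x -> 0 <= f x) -> `|f x| <= `|f (modulus x)|.
Proof.
move=> f0; apply: norm_dominated; rewrite -?linearN;
  apply: pos_linear_mono => //.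
  by rewrite -levN2 opprK leUr.
by rewrite leUl.
Qed.

Lemma Lr_bounded (T : Lr X) :
  exists2 M : R, 0 < M & forall x, `|T x| <= M * `|x|.
Proof.
have cT : continuous T.
  have /asboolP := LrP T.
  apply: (_ : _ `<=` [set S : X -> X | continuous S]).
  apply: smallest_sub; last by move=> S [].
  split=> [x|a S S' cS cS' x]; first exact: cst_continuous.
  by apply: cvgD; [apply: cvgZr; exact: cS|exact: cS'].
have /linear_boundedP := continuous_linear_bounded 0 (cT 0).
move=> /pinfty_ex_gt0[M M0 h]; by exists M.
Qed.

Lemma Lr_ex (f : {linear X -> X}) (M : R) : (forall x, 0 <= x -> 0 <= f x) ->
  (forall x, `|f x| <= M * `|x|) -> exists2 T : Lr X, 0 <= T & T =1 f.
Proof.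
move=> f0 fM; have pf : positive_operator f.
  split=> //; first exact: linearP.
  apply: bounded_linear_continuous; apply/linear_boundedP; near=> r => x.
  have r1 : M <= r by near: r; apply: nbhs_pinfty_ge; rewrite num_real.
  by apply: le_trans (fM x) _; rewrite ler_wpM2r.
have freg : (f : X -> X) \in @regular R X.
  by apply/asboolP; exact: sub_gen_smallest.
by exists (MkLr freg) => //; apply/Lr_leP => x x0; exact: f0.
Unshelve. all: by end_near. Qed.

Lemma Lr_ge0P (T : Lr X) : reflect (forall x, 0 <= x -> 0 <= T x) (0 <= T).
Proof. by apply: (iffP (@Lr_leP _ _ 0 T)) => h x x0; exact: h. Qed.

Lemma Lr_mono (T : Lr X) x y : 0 <= T -> x <= y -> T x <= T y.
Proof. by move/Lr_ge0P; exact: pos_linear_mono. Qed.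

Lemma Lr_generating : generating_cone (Lr X).
Proof.
move=> T; suff [U [V [U0 V0 TE]]] : exists U V : Lr X,
    [/\ 0 <= U, 0 <= V & (T : X -> X) = U \- V].
  by exists U, V; split=> //; apply: val_inj; rewrite /= TE.
have /asboolP := LrP T.
apply: (_ : _ `<=` [set S : X -> X | exists U V : Lr X,
    [/\ 0 <= U, 0 <= V & S = U \- V]]).
apply: smallest_sub; first split.
- by exists 0, 0; split=> //; apply/funext => x /=; rewrite subrr.
- move=> a _ _ [U [V [U0 V0 ->]]] [U' [V' [U'0 V'0 ->]]].
  have [a0|a0] := leP 0 a.
    exists (a *: U + U'), (a *: V + V'); split; rewrite ?addv_ge0 ?scalev_ge0//.
    by apply/funext => x /=; rewrite !fctE scalerBr opprD addrACA.
  exists ((- a) *: V + U'), ((- a) *: U + V').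
  have na0 : 0 <= - a by rewrite oppr_ge0 ltW.
  split; rewrite ?addv_ge0 ?scalev_ge0//.
  apply/funext => x /=; rewrite !fctE scalerBr opprD !scaleNr opprK.
  change ((U' \- V') x) with (U' x - V' x).
  by rewrite [RHS]addrACA [_ + a *: U x]addrC.
move=> S Spos.
have Sreg : S \in @regular R X by apply/asboolP; exact: sub_gen_smallest.
exists (MkLr Sreg), 0; split => //.
  by apply/Lr_leP => x x0; case: Spos => _ _; exact.
by apply/funext => x /=; rewrite subr0.
Qed.

(* x /\ y <= 0; for x, y >= 0 this is disjointness. *)
Definition disj x y := forall w, w <= x -> w <= y -> w <= 0.

(** If [w] is below both parts, [posv x - w] still dominates [x] and [0], so minimality of [posv x]
    forces [w <= 0]. *)
Lemma posv_disj x : disj (posv x) (posv (- x)).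
Proof.
move=> w wx wnx.
have : posv x <= posv x - w.
  rewrite [leLHS]/posv leUx subv_ge0 wx andbT levBrDr addrC -levBrDr.
  apply: (le_trans wnx); rewrite posv_le subv_ge0 le_posv andbT.
  by rewrite addrC lev_wpDr// posv_ge0.
by rewrite levBrDr addrC -levBrDr subrr.
Qed.

Lemma bp_posv_le0 (P : bandProj X) x : P x <= 0 -> P (posv x) = 0.
Proof.
move=> Px; apply/le_anti; rewrite bp_ge0 ?posv_ge0// andbT.
have : posv x <= posv x - P (posv x).
  rewrite [leLHS]/posv leUx subv_ge0 bp_le ?posv_ge0// andbT.
  apply: le_trans (bp_mono (bp_compl P) (le_posv x)) => /=.
  by rewrite levBrDr gev_wDr.
by rewrite levBrDr addrC -levBrDr subrr.
Qed.

End BanachLattice.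

(** * Infima of operators and principal band projections *)

Section DedekindComplete.
Context {R : realType} {X : banachLatticeType R} (hX : dedekind_complete X).
Implicit Types (x y z w : X) (c t : R).

Lemma inf_ex (I : Type) (u : I -> X) (i0 : I) w : (forall i, w <= u i) ->
  exists m, is_inf u m.
Proof.
move=> wu; have [|m [m1 m2]] := hX (A := [set v | forall i, v <= u i]).
  by split; [exists w|exists (u i0) => v /(_ i0)].
exists m; split=> [i|v vu]; last exact: m1.
by apply: m2 => v; exact.
Qed.

(** Directedness makes the pointwise infimum additive on the cone; its extension is dominated by
    [T i0] there and inherits the norm bound of [T i0]. *)
Lemma Lr_inf_ex (I : Type) (T : I -> Lr X) (i0 : I) : (forall i, 0 <= T i) ->
  (forall i j, exists k, T k <= T i /\ T k <= T j) -> exists S, is_inf T S.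
Proof.
move=> T0 TD.
have ex x : exists m, 0 <= x -> is_inf (fun i => T i x) m.
  have [x0|] := boolP (0 <= x); last by exists 0.
  have [|m mP] := inf_ex (u := fun i => T i x) i0 (w := 0); last by exists m.
  by move=> i; exact/Lr_ge0P.
have [f fP] := choice ex.
have [||g gf] := @cone_extend _ _ X f vl_generating.
- move=> x y x0 y0; apply: is_inf_unique (fP _ (addv_ge0 x0 y0)) _.
  rewrite (_ : (fun _ => _) = (fun i => T i x + T i y)).
    apply: is_infD; [|exact: fP|exact: fP] => i j.
    have [k [/Lr_leP ki /Lr_leP kj]] := TD i j.
    by exists k; rewrite ki// kj.
  by apply/funext => i; rewrite linearD.
- move=> c x c0 x0; apply: is_inf_unique (fP _ (scalev_ge0 _ _ (ltW c0) x0)) _.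
  rewrite (_ : (fun _ => _) = (fun i => c *: T i x)).
    by apply: is_infZ => //; exact: fP.
  by apply/funext => i; rewrite linearZ.
have g0 x : 0 <= x -> 0 <= g x.
  by move=> x0; rewrite gf//; apply: (fP _ x0).2 => i; exact/Lr_ge0P.
have [M M0 TM] := Lr_bounded (T i0).
have [x|S S0 Sg] := Lr_ex (M := M) g0.
  apply: le_trans (pos_linear_norm _ g0) _.
  have m0 := modulus_ge0 x; rewrite -[`|x|]norm_modulus.
  apply: le_trans (TM (modulus x)); apply: norm_mono; first exact: g0.
  by rewrite gf//; exact: (fP _ m0).1.
exists S; split=> [i|U UT]; apply/Lr_leP => x x0; rewrite Sg gf//.
  exact: (fP _ x0).1.
by apply: (fP _ x0).2 => i; have /Lr_leP := UT i; exact.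
Qed.

Lemma Lr_bp_inf (I : Type) (P : I -> bandProj (Lr X)) :
  exists Q : bandProj (Lr X), (forall i T, P i (Q T) = Q T) /\
    (forall T, 0 <= T -> (forall i, P i T = T) -> Q T = T).
Proof.
by apply: bp_inf => [|T]; [exact: Lr_generating|exact: (Lr_inf_ex [::])].
Qed.

(** With [c] replaced by a larger natural number, induction applies: if [w] is below [(n + 1) x],
    then [w - n x] is below both [x] and [y], so [w <= n x]. *)
Lemma disj_scale x y c w : 0 <= x -> disj y x ->
  w <= y -> w <= c *: x -> w <= 0.
Proof.
move=> x0 dyx wy wc.
have {c wc} [n] : exists n : nat, w <= n%:R *: x.
  exists (Num.Def.archi_bound `|c|); apply: (le_trans wc).
  rewrite -subv_ge0 -scalerBl scalev_ge0// subr_ge0.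
  by apply: ltW; apply: le_lt_trans (ler_norm _) _; exact/archi_boundP.
elim: n w wy => [|n IH] w wy; first by rewrite scale0r.
rewrite -addn1 natrD scalerDl scale1r addrC -levBlDr => wx.
apply: IH => //; rewrite -[n%:R *: x]add0r -levBlDr.
apply: dyx => //; apply: le_trans wy; apply: gev_wBr.
by rewrite scalev_ge0.
Qed.

(* The complementary projection of a positive [y] is the infimum of
   [(y - t x)^+] over [t >= 0]; indexing by [`|t|] over all of [R] lets the
   index be rescaled in the proof of homogeneity. *)
Lemma principal_bandProj x : 0 <= x -> exists P : bandProj X,
  forall y, 0 <= y -> is_inf (fun t => posv (y - `|t| *: x)) (y - P y).
Proof.
move=> x0.
pose u y t := posv (y - `|t| *: x).
have u0 y t : 0 <= u y t by exact: posv_ge0.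
have tx t : 0 <= `|t| *: x by rewrite scalev_ge0.
have ud y s t : s <= t -> 0 <= s -> u y t <= u y s.
  move=> st s0; apply: posv_mono; apply: levD => //; rewrite levN2.
  rewrite -subv_ge0 -scalerBl scalev_ge0// subr_ge0 !ger0_norm//.
  exact: le_trans st.
have ex y : exists m, is_inf (u y) m.
  by apply: (inf_ex 0 (w := 0)) => t; exact: u0.
have [f fP] := choice ex.
have f0 y : 0 <= f y by apply: (fP y).2.
have fle y t : f y <= u y t by apply: (fP y).1.
have fley y : 0 <= y -> f y <= y.
  by move=> y0; have := fle y 0; rewrite /u normr0 scale0r subr0 posv_id.
have fix_f y : 0 <= y -> disj y x -> f y = y.
  move=> y0 dyx; apply: le_anti; rewrite fley//=; apply: (fP y).2 => t.
  rewrite -subv_ge0 -levN2 opprB oppr0; apply: (disj_scale x0 dyx (c := `|t|)).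
    exact: gev_wBr.
  by rewrite levBlDr addrC -levBlDr le_posv.
have df y : disj (f y) x.
  move=> w wf wx; apply: le_trans (le_posv w) _.
  have wf' : posv w <= f y by rewrite posv_le wf f0.
  have wx' : posv w <= x by rewrite posv_le wx x0.
  suff : f y + posv w <= f y by rewrite addrC -levBrDr subrr.
  (* Raising the index by one subtracts one more [x], which leaves room for [posv w <= x]. *)
  apply: (fP y).2 => t; rewrite -levBrDr; apply: le_trans (fle y (`|t| + 1)) _.
  rewrite posv_le subv_ge0 (le_trans wf') ?fle// andbT levBrDr.
  apply: le_trans (le_posv _); rewrite ger0_norm ?addr_ge0// scalerDl scale1r.
  by rewrite opprD addrA -[_ - x + _]addrA gev_wDr// addrC levBlDr add0r.
have [|||N Nf] := @bandProj_extend _ _ f vl_generating.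
- move=> y z y0 z0; apply: is_inf_unique (fP _) _.
  have D : is_inf (fun t => u y t + u z t) (f y + f z).
    apply: is_infD => // s t; exists (`|s| + `|t|).
    have h (v : X) (r : R) : u v r = u v `|r| by rewrite /u normr_id.
    by rewrite [u y s]h [u z t]h !ud ?lerDl ?lerDr.
  split=> [t|w wu].
    apply: le_trans (D.1 t) _; rewrite -levBrDr /u.
    rewrite posv_le; apply/andP; split.
      rewrite levBrDr addrC -levBrDr posv_le; apply/andP; split.
        rewrite levBrDr; apply: le_trans (le_posv _).
        by rewrite [leLHS]addrC -[leRHS]addrA levD// gev_wBr.
      rewrite subv_ge0; apply: le_trans (le_posv _).
      by rewrite addrAC; exact: lev_wpDr.
    rewrite subv_ge0; apply: posv_mono; apply: levD => //.
    by rewrite addrC; exact: lev_wpDr.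
  (* The doubled index leaves one multiple of [x] for each of [y] and [z]. *)
  apply: D.2 => t; apply: le_trans (wu (2 * `|t|)) _.
  rewrite /u (_ : _ - _ = (y - `|t| *: x) + (z - `|t| *: x)) ?posvD//.
  rewrite ger0_norm ?mulr_ge0// -scalerA scaler_nat mulr2n opprD.
  by rewrite addrACA.
- move=> c y c0 y0; apply: is_inf_unique (fP _) _.
  have D := is_infZ c0 (fP y).
  have uc t : u (c *: y) t = c *: u y (t / c).
    rewrite /u -posvZ// scalerBr scalerA normrM normrV ?unitfE ?gt_eqF//.
    by rewrite (gtr0_norm c0) mulrCA divff ?gt_eqF// mulr1.
  split=> [t|w wu]; first by rewrite uc; exact: D.1.
  by apply: D.2 => t; have := wu (t * c); rewrite uc mulfK ?gt_eqF.
- by move=> y y0; split; [exact: f0|exact: fley|apply: fix_f].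
exists (bp_compl N) => y y0.
by rewrite /= subKr Nf//; exact: fP.
Qed.

End DedekindComplete.

(** * The Hahn-Banach theorem *)

Section HahnBanach.
Context {R : realType}.

Section InfFamily.
Context (I : Type) (i0 : I).
Implicit Types u v w : I -> R.

Definition bounded_below u := exists m, forall i, m <= u i.

Lemma inf_range_le u i : bounded_below u -> inf (range u) <= u i.
Proof.
by move=> [m mu]; apply: ge_inf; [exists m => _ [j _ <-]|exists i].
Qed.

Lemma le_inf_range u m : (forall i, m <= u i) -> m <= inf (range u).
Proof.
by move=> mu; apply: lb_le_inf; [exists (u i0), i0|move=> _ [j _ <-]].
Qed.

Lemma inf_range_addr u v w : bounded_below w ->
  (forall i j, exists k, w k <= u i + v j) ->
  inf (range w) <= inf (range u) + inf (range v).
Proof.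
move=> wb h; rewrite -lerBlDr; apply: le_inf_range => i.
rewrite lerBlDr -lerBlDl; apply: le_inf_range => j.
rewrite lerBlDl; have [k] := h i j.
by apply: le_trans; exact: inf_range_le.
Qed.

Lemma inf_range_scale u w c : 0 < c -> bounded_below w ->
  (forall i, exists k, w k <= c * u i) -> inf (range w) <= c * inf (range u).
Proof.
move=> c0 wb h; rewrite mulrC -ler_pdivrMr//; apply: le_inf_range => i.
rewrite ler_pdivrMr// mulrC; have [k] := h i.
by apply: le_trans; exact: inf_range_le.
Qed.

End InfFamily.

Context {V : lmodType R}.
Implicit Types (p q : V -> R) (x y : V).

Definition sublinear p :=
  (forall x y, p (x + y) <= p x + p y) /\
  (forall c x, 0 < c -> p (c *: x) <= c * p x).

Lemma sublinear0 p : sublinear p -> p 0 = 0.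
Proof.
move=> [_ pZ]; have := pZ 2 0; have := pZ 2^-1 0.
rewrite invr_gt0 ltr0n !scaler0 => /(_ isT) + /(_ isT); lra.
Qed.

Lemma sublinearZ p c x : sublinear p -> 0 < c -> p (c *: x) = c * p x.
Proof.
move=> [_ pZ] c0; apply/le_anti; rewrite pZ//=.
rewrite -ler_pdivlMl//; have := pZ c^-1 (c *: x).
by rewrite invr_gt0 scalerA mulVf ?gt_eqF// scale1r; exact.
Qed.

Lemma sublinearN p x : sublinear p -> - p (- x) <= p x.
Proof.
move=> sp; have := sp.1 x (- x); rewrite subrr sublinear0//.
by rewrite -lerBlDr sub0r.
Qed.

(** The value at [- y] is at most [- q y], so a linear functional below this one is at least [q y]
    at [y]. The absolute value stands for a parameter in the half line. *)
Definition sublinear_at q y x : R :=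
  inf (range (fun t : R => q (x + `|t| *: y) - `|t| * q y)).

Lemma sublinear_at_bounded q y x : sublinear q ->
  bounded_below (fun t : R => q (x + `|t| *: y) - `|t| * q y).
Proof.
move=> sq; exists (- q (- x)) => t.
have [->|t0] := eqVneq t 0.
  by rewrite normr0 scale0r mul0r addr0 subr0 sublinearN.
rewrite -sublinearZ ?normr_gt0// lerBrDr addrC lerBlDr.
by apply: le_trans (sq.1 _ _); rewrite [x + _]addrC addrK.
Qed.

Lemma sublinear_at_le q y x (t : R) : sublinear q -> 0 <= t ->
  sublinear_at q y x <= q (x + t *: y) - t * q y.
Proof.
move=> sq t0.
by have := inf_range_le t (sublinear_at_bounded y x sq); rewrite ger0_norm.
Qed.

Lemma sublinear_at_sub q y : sublinear q -> sublinear (sublinear_at q y).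
Proof.
move=> sq; split=> [x z|c x c0].
- apply: (inf_range_addr 0) => [|s t]; first exact: sublinear_at_bounded.
  exists (`|s| + `|t|); rewrite ger0_norm ?addr_ge0//.
  rewrite addrACA -opprD -mulrDl lerD2r scalerDl addrACA; exact: sq.1.
- apply: (inf_range_scale 0) => //; first exact: sublinear_at_bounded.
  move=> t; exists (c * t); rewrite normrM gtr0_norm// mulrBr mulrA lerD2r.
  by rewrite -scalerA -scalerDr; exact: sq.2.
Qed.

(** Zorn for the reversed order. The pointwise infimum of a nonempty chain is finite because every
    sublinear [q] below [p] satisfies [- p (- x) <= q x]; the empty chain is bounded by [p]. *)
Lemma sublinear_minimal p : sublinear p ->
  exists2 q, sublinear q /\ (forall x, q x <= p x) &
    forall r, sublinear r -> (forall x, r x <= q x) -> r = q.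
Proof.
move=> sp; pose T := {q : V -> R | sublinear q /\ forall x, q x <= p x}.
pose le (s t : T) := `[< forall x, sval t x <= sval s x >].
have [||||[q [sq qp]] qmax] := @Zorn T le.
- by move=> t; apply/asboolP.
- move=> r s t /asboolP rs /asboolP st; apply/asboolP => x.
  exact: le_trans (st x) (rs x).
- move=> [s hs] [t ht] /asboolP st /asboolP ts; apply: eq_exist.
  by apply/funext => x; apply/le_anti; rewrite st ts.
- move=> A Atot; have [[t0 At0]|A0] := pselect (exists t, A t); last first.
    exists (exist _ p (conj sp (fun x => lexx (p x)))) => s As.
    by exfalso; apply: A0; exists s.
  pose I := {t : T | A t}; pose i0 : I := exist _ t0 At0.
  pose u x (i : I) := sval (sval i) x.
  have ub x : bounded_below (u x).
    exists (- p (- x)) => -[[q [sq qp]] Aq] /=; rewrite /u/=.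
    by apply: le_trans (sublinearN x sq); rewrite lerN2.
  have sinf : sublinear (fun x => inf (range (u x))).
    split=> [x y|c x c0].
      apply: (inf_range_addr i0) => // -[s As] [t At].
      have [/asboolP st|/asboolP ts] := Atot _ _ As At.
        exists (exist _ t At); apply: le_trans ((svalP t).1.1 _ _) _.
        by rewrite lerD2r; exact: st.
      exists (exist _ s As); apply: le_trans ((svalP s).1.1 _ _) _.
      by rewrite lerD2l; exact: ts.
    apply: (inf_range_scale i0) => // i; exists i.
    exact: (svalP (sval i)).1.2.
  have infp x : inf (range (u x)) <= p x.
    by apply: le_trans (inf_range_le i0 (ub x)) _; exact: (svalP t0).2.
  exists (exist (fun q => sublinear q /\ forall x, q x <= p x) _
    (conj sinf infp)) => s As; apply/asboolP => x /=.
  exact: (inf_range_le (exist _ s As : I) (ub x)).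
exists q => // r sr rq.
have rp x : r x <= p x by exact: le_trans (rq x) (qp x).
have := qmax (exist _ r (conj sr rp)).
by move=> /(_ _)/(congr1 sval) /= ->//; apply/asboolP.
Qed.

(* A minimal sublinear functional [q] is additive because
   [inf_t q (x + t y) - t q y] is again sublinear and below [q]; starting from
   [inf_t p (x + t x0) - t p x0] forces the value at [x0]. *)
Theorem hahn_banach p x0 : sublinear p ->
  exists2 f : {scalar V}, forall x, f x <= p x & f x0 = p x0.
Proof.
move=> sp.
have sp0 := sublinear_at_sub x0 sp.
have [q [sq qp] qmin] := sublinear_minimal sp0.
have at_le q' y x : sublinear q' -> sublinear_at q' y x <= q' x.
  move=> sq'; have := sublinear_at_le y x sq' (lexx 0).
  by rewrite scale0r mul0r addr0 subr0.
have qD x y : q (x + y) = q x + q y.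
  apply/le_anti; rewrite sq.1/= -lerBrDr.
  (* By minimality [q x] equals [sublinear_at q y x], which is then bounded by its term at
     [t = 1]. *)
  rewrite -[X in X x](qmin _ (sublinear_at_sub y sq)).
    2: by move=> z; exact: at_le.
  by have := sublinear_at_le y x sq ler01; rewrite scale1r mul1r.
have qN x : q (- x) = - q x.
  by apply/eqP; rewrite -addr_eq0 -qD addNr sublinear0.
have linq : linear_for *%R q.
  move=> c x y; rewrite qD; congr (_ + _).
  have [c0|c0|->] := ltgtP c 0; first 1 last.
  - exact: sublinearZ.
  - by rewrite scale0r mul0r sublinear0.
  rewrite -[c *: x]opprK qN -scaleNr sublinearZ ?oppr_gt0//.
  by rewrite mulNr opprK.
pose H := GRing.isLinear.Build R V R *%R _ linq.
pose f : {scalar V} := HB.pack q H.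
exists f => [x|] /=; first exact: le_trans (qp x) (at_le _ _ _ sp).
apply/le_anti; rewrite (le_trans (qp x0) (at_le _ _ _ sp))/=.
rewrite -lerN2 -qN; apply: le_trans (qp _) _.
have := sublinear_at_le x0 (- x0) sp ler01.
by rewrite scale1r mul1r addNr sublinear0// sub0r.
Qed.

End HahnBanach.

(** * Rank one operators and the band projections [T |-> P T Q] *)

Section RankOne.
Context {R : realType} {X : banachLatticeType R}.
Implicit Types (x y z w : X) (c t : R).

(** The bound on [p] is [0] at negative elements, which makes [f] positive, and at most the norm
    everywhere, which makes [f] a contraction. Leaving [p] free allows both the norm of the positive
    part and its infimum over atom tails. *)
Lemma rank1_ex (p : X -> R) x0 z : sublinear p ->
  (forall y, p y <= `|posv y|) -> 0 <= z ->
  exists f : {scalar X}, exists T : Lr X,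
    [/\ forall x, f x <= p x, f x0 = p x0, forall x, 0 <= x -> 0 <= f x,
        0 <= T & forall x, T x = f x *: z].
Proof.
move=> sp pn z0; have [f fp fx0] := hahn_banach x0 sp.
have f0 x : 0 <= x -> 0 <= f x.
  move=> x0'; rewrite -lerN2 oppr0 -linearN; apply: le_trans (fp _) _.
  apply: le_trans (pn _) _; rewrite posv_eq0 ?normr0//.
  by rewrite -levN2 opprK oppr0.
have fn x : `|f x| <= `|x|.
  have h y : f y <= `|y|.
    by apply: le_trans (fp y) (le_trans (pn y) _); exact: norm_posv.
  by rewrite ler_norml h andbT lerNl -linearN -(normrN x).
have ling : linear (fun x => f x *: z).
  by move=> c x y; rewrite linearP scalerDl scalerA.
pose H := GRing.isLinear.Build R X X *:%R _ ling.
pose g : {linear X -> X} := HB.pack (fun x => f x *: z) H.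
have [||T T0 TE] := @Lr_ex _ _ g `|z|.
- by move=> x x0'; rewrite /= scalev_ge0 ?f0.
- by move=> x /=; rewrite normrZ mulrC ler_wpM2l.
by exists f, T; split.
Qed.

Lemma sublinear_norm_posv : sublinear (fun y : X => `|posv y|).
Proof.
split=> [x y|c x c0]; last by rewrite posvZ// normrZ gtr0_norm.
apply: le_trans (ler_normD _ _); apply: norm_mono; first exact: posv_ge0.
exact: posvD.
Qed.

Lemma sandwich_linear (P Q : bandProj X) : linear (sandwich P Q).
Proof.
by move=> a S T; apply: val_inj; apply/funext => x /=; rewrite linearP.
Qed.

HB.instance Definition _ (P Q : bandProj X) :=
  GRing.isLinear.Build R (Lr X) (Lr X) *:%R (sandwich P Q)
    (sandwich_linear P Q).

Lemma sandwich_ge0 (P Q : bandProj X) (T : Lr X) :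
  0 <= T -> 0 <= sandwich P Q T.
Proof.
move=> T0; apply/Lr_ge0P => x x0.
by rewrite /= bp_ge0//; apply: (Lr_ge0P _ T0); exact: bp_ge0.
Qed.

Lemma sandwich_le (P Q : bandProj X) (T : Lr X) : 0 <= T -> sandwich P Q T <= T.
Proof.
move=> T0; apply/Lr_leP => x x0; rewrite /=.
have Qx := bp_ge0 Q x0.
apply: (le_trans (bp_le _ (Lr_ge0P _ T0 _ Qx))).
by apply: Lr_mono => //; exact: bp_le.
Qed.

Lemma sandwich_band_projection (P Q : bandProj X) :
  band_projection (sandwich P Q).
Proof.
split=> [T|T T0]; last by rewrite sandwich_ge0// sandwich_le.
by apply: val_inj; apply/funext => x /=; rewrite !bp_idem.
Qed.

Definition bp_sandwich (P Q : bandProj X) : bandProj (Lr X) :=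
  BandProj (sandwich_band_projection P Q).

End RankOne.

(** * Atoms *)

Section Atoms.
Context {R : realType} {X : banachLatticeType R} (hX : dedekind_complete X).
Implicit Types (x y z w : X) (c t : R).

(** Infimum of the complements: being fixed by [I - P i] means being killed by [P i]. Both
    projections on which innerness is tested arise this way. *)
Lemma Lr_bp_common_kernel (I : Type) (P : I -> bandProj (Lr X)) :
  exists Q : bandProj (Lr X), (forall i T, P i (Q T) = 0) /\
    (forall T, 0 <= T -> (forall i, P i T = 0) -> Q T = T).
Proof.
have [Q [Q1 Q2]] := Lr_bp_inf hX (fun i => bp_compl (P i)).
exists Q; split=> [i T|T T0 PT].
  have /eqP := Q1 i T.
  by rewrite /= -subr_eq0 addrAC subrr add0r oppr_eq0 => /eqP.
by apply: Q2 => // i; rewrite /= PT subr0.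
Qed.

(** The last clause is one half of the formula giving [P y] as the supremum over [t] of the meets of
    [y] and [t *: x]. *)
Lemma principal_bandProjP x : 0 <= x -> exists P : bandProj X,
  [/\ P x = x, forall y, 0 <= y -> disj y x -> P y = 0,
      forall y, 0 <= y -> P y = 0 -> disj y x &
      forall y z, 0 <= y ->
        (forall t w, 0 <= t -> w <= y -> w <= t *: x -> w <= z) -> P y <= z].
Proof.
move=> x0; have [P hP] := principal_bandProj hX x0.
have le_P y z : 0 <= y ->
    (forall t w, 0 <= t -> w <= y -> w <= t *: x -> w <= z) -> P y <= z.
  move=> y0 h; rewrite -(levB2l y); apply: (hP y y0).2 => t.
  rewrite levBlDr addrC -levBlDr; apply: (h `|t|) => //.
    exact/gev_wBr/posv_ge0.
  by rewrite levBlDr addrC -levBlDr le_posv.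
exists P; split=> //.
- apply/le_anti; rewrite bp_le//=.
  have := (hP x x0).1 1.
  by rewrite normr1 scale1r subrr posv_id// levBlDr add0r; exact.
- move=> y y0 dyx; apply/le_anti; rewrite bp_ge0// andbT.
  apply: le_P => // t w t0.
  exact: disj_scale.
- move=> y y0 Py w wy wx; apply: le_trans (le_posv w) _.
  have := (hP y y0).1 1; rewrite Py subr0 normr1 scale1r => h.
  have : y <= y - posv w.
    apply: le_trans h _; rewrite posv_le levB2l posv_le wx x0/=.
    by rewrite subv_ge0 posv_le wy.
  by rewrite levBrDr addrC -levBrDr subrr.
Qed.

Lemma atom_multiple a x c : atom a -> 0 <= x -> 0 <= c -> x <= c *: a ->
  exists2 d, 0 <= d & x = d *: a.
Proof.
move=> [a0 ha] x0 c0 xca; have [c_eq0|cn0] := eqVneq c 0.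
  exists 0 => //; rewrite scale0r; apply/le_anti; rewrite x0 andbT.
  by rewrite c_eq0 scale0r in xca.
have cp : 0 < c by rewrite lt0r cn0.
have cK z : z = c *: (c^-1 *: z) by rewrite scalerA divff// scale1r.
have [||d d0 dE] := ha (c^-1 *: x).
- by rewrite scalev_ge0// invr_ge0.
- by rewrite -(lev_pscale _ _ cp) -cK.
by exists (c * d); rewrite ?mulr_ge0// -scalerA -dE -cK.
Qed.

(** Normalization selects one atom on each ray, so that distinct indices give disjoint
    projections. *)
Definition unit_atom : Type := {a : X | atom a /\ `|a| = 1}.

Definition uval (a : unit_atom) : X := sval a.

Lemma unit_atomP (a : unit_atom) : atom (uval a).
Proof. exact: (svalP a).1. Qed.

Lemma unit_atom_norm (a : unit_atom) : `|uval a| = 1.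
Proof. exact: (svalP a).2. Qed.

Lemma unit_atom_ge0 (a : unit_atom) : 0 <= (uval a).
Proof. by have [/ltW] := unit_atomP a. Qed.

Lemma unit_atom_of a : atom a -> exists u : unit_atom, a = `|a| *: uval u.
Proof.
move=> aa; have [a0 ha] := aa.
have na : 0 < `|a| by rewrite normr_gt0 gt_eqF.
have ua : atom (`|a|^-1 *: a) /\ `|(`|a|^-1 *: a)| = 1.
  split; last by rewrite normrZ ger0_norm ?invr_ge0// mulVf// gt_eqF.
  split=> [|y y0 ya].
    rewrite lt_def scaler_eq0 invr_eq0 normr_eq0 orbb gt_eqF//=.
    by rewrite scalev_ge0 ?invr_ge0// ltW.
  have [|d d0 ->] := atom_multiple aa y0 _ ya; first by rewrite invr_ge0.
  exists (d * `|a|); first by rewrite mulr_ge0.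
  by rewrite scalerA -mulrA mulfV ?gt_eqF// mulr1.
exists (exist (fun b : X => atom b /\ `|b| = 1) _ ua).
by rewrite /uval /= scalerA mulfV ?gt_eqF// scale1r.
Qed.

(** For [y >= 0], an element below [y] and a multiple of the atom has positive part [d *: uval a]
    with [d] at most the norm of [y]. This bound does not depend on the multiple, so [P y] is itself
    below a multiple of the atom. *)
Lemma atom_bandProj (a : unit_atom) : exists P : bandProj X,
  (forall y, 0 <= y -> P y = 0 -> disj y (uval a)) /\
  (forall y, exists t, P y = t *: uval a).
Proof.
have a0 := unit_atom_ge0 a; have aP := unit_atomP a.
have [P [_ _ Pd Ple]] := principal_bandProjP a0.
exists P; split=> //.
suff h y : 0 <= y -> exists t, P y = t *: uval a.
  move=> y; have [u [v [/h[s us] /h[t vt] ->]]] := pos_decomp y.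
  by exists (s - t); rewrite linearB us vt scalerBl.
move=> y0.
have [|d d0 ->] := atom_multiple aP (bp_ge0 P y0) (normr_ge0 y); last by exists d.
apply: Ple => // t w t0 wy wt; apply: le_trans (le_posv w) _.
have [|d d0 dE] := atom_multiple aP (posv_ge0 w) t0.
  by rewrite posv_le wt scalev_ge0.
rewrite dE -subv_ge0 -scalerBl scalev_ge0// subr_ge0.
have : `|posv w| <= `|y| by rewrite norm_mono ?posv_ge0// posv_le wy.
by rewrite dE normrZ unit_atom_norm mulr1 ger0_norm.
Qed.

Definition aproj (a : unit_atom) : bandProj X := sval (cid (atom_bandProj a)).

Lemma aproj_disj a y : 0 <= y -> aproj a y = 0 -> disj y (uval a).
Proof. by rewrite /aproj; case: cid => P [h ?]; exact: h. Qed.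

Lemma aproj_mult a y : exists t, aproj a y = t *: uval a.
Proof. by rewrite /aproj; case: cid => P []. Qed.

Lemma aproj_norm a y : 0 <= y -> aproj a y = `|aproj a y| *: uval a.
Proof.
move=> /(bp_ge0 (aproj a)); have [t ->] := aproj_mult a y => ta0.
rewrite normrZ unit_atom_norm mulr1; have [t0|t0] := leP 0 t.
  by rewrite ger0_norm.
suff -> : uval a = 0 by rewrite !scaler0.
apply/le_anti; rewrite unit_atom_ge0 andbT.
rewrite -(@lev_pscale _ _ (- t)) ?oppr_gt0// scaler0 scaleNr.
by rewrite -levN2 opprK oppr0.
Qed.

(* [x] minus its components along the atoms in [s]. *)
Definition atom_tail (s : seq unit_atom) : X -> X :=
  bp_comp (fun a => bp_compl (aproj a)) s.

Lemma atom_tail_ex s : exists Q : bandProj X, Q =1 atom_tail s.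
Proof. exact: bp_comp_ex vl_generating s. Qed.

Lemma atom_tail_cons a s x :
  atom_tail (a :: s) x = atom_tail s x - aproj a (atom_tail s x).
Proof. by []. Qed.

Definition atoms_total :=
  forall x, 0 <= x -> (forall a, disj x (uval a)) -> x = 0.

(** The positive part of a lower bound lies below each one-atom tail, so every [aproj a] kills
    it. *)
Lemma atom_tail_inf x : atoms_total ->
  0 <= x -> is_inf (fun s => atom_tail s x) 0.
Proof.
move=> tot x0; split=> [s|w wx].
  by have [Q QE] := atom_tail_ex s; rewrite -QE bp_ge0.
suff <- : posv w = 0 by exact: le_posv.
apply: tot; first exact: posv_ge0.
move=> a; apply: aproj_disj; first exact: posv_ge0.
apply: (bp_kills (y := atom_tail [:: a] x)) => //; first exact: posv_ge0.
  rewrite posv_le wx /=; exact: (bp_ge0 (bp_compl (aproj a))).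
by rewrite /= linearB /= bp_idem subrr.
Qed.

Lemma sub_tail (E : set X) s x : linear_subspace E ->
  (forall (a : unit_atom) y, E (aproj a y)) -> E (x - atom_tail s x).
Proof.
move=> [E0 ED] Ea; elim: s => [|a s IH]; first by rewrite /atom_tail /= subrr.
by rewrite atom_tail_cons opprB addrCA -[aproj _ _]scale1r; apply: ED.
Qed.

(** If [x] is disjoint from all atoms, the kernel of its principal projection is a band containing
    them, hence all of [X]. Conversely a positive [x] is the supremum of the differences
    [x - atom_tail s x], which are finite combinations of atoms. *)
Lemma atomicP : atomic X <-> atoms_total.
Proof.
split=> [at_X x x0 dx|tot].
  have [P [Px P0 _ _]] := principal_bandProjP x0.
  suff : P x = 0 by rewrite Px.
  have Pmod y : P y = 0 -> P (modulus y) = 0.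
    move=> Py; apply: (bp_kills (y := posv y + posv (- y))).
    - exact: modulus_ge0.
    - rewrite leUx (le_trans (le_posv y)) ?lev_wpDr ?posv_ge0//=.
      by rewrite addrC (le_trans (le_posv (- y))) ?lev_wpDr ?posv_ge0.
    - by rewrite linearD /= !bp_posv_le0 ?linearN /= ?Py ?oppr0// addr0.
  have : smallest (@band R X) [set a | atom a] x by rewrite [smallest _ _]at_X.
  move=> /(_ [set y | P y = 0]); apply; split=> [|a aa /=]; first split.
  - split=> [|c y z Py Pz]; first by rewrite /= linear0.
    by rewrite /= linearP Py Pz scaler0 addr0.
  - move=> y z /= Pz yz.
    have Py : P (modulus y) = 0.
      by apply: (bp_kills (y := modulus z)); rewrite ?modulus_ge0// Pmod.
    apply/le_anti; rewrite -{1}Py bp_mono ?leUl//= -levN2 oppr0 -linearN.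
    by rewrite -Py bp_mono// leUr.
  - move=> A s AP [sA sl] /=; apply/le_anti/andP; split.
      have : s <= s - P s.
        apply: sl => a Aa; have := bp_mono (bp_compl P) (sA _ Aa).
        by rewrite /= (AP _ Aa) subr0.
      by rewrite levBrDr addrC -levBrDr subrr.
    (* A supremum of the empty set would be a least element of [X]; comparing it with its double
       shows that it is nonnegative. *)
    have [[a Aa]|A0] := pselect (A !=set0).
      by rewrite -(AP _ Aa) bp_mono// sA.
    apply: bp_ge0; have : s <= s + s.
      by apply: sl => a Aa; exfalso; apply: A0; exists a.
    by rewrite -levBlDr subrr.
  - have [a0 ha] := aa; apply: P0; first exact: ltW.
    have [u au] := unit_atom_of aa.
    move=> w wa wx; apply: (disj_scale (c := `|a|) (unit_atom_ge0 u) (dx u) wx).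
    by rewrite -au.
rewrite /atomic; apply/seteqP; split=> // y _ B [[sB solid sup] aB].
have Bpos x : 0 <= x -> B x.
  move=> x0; apply: (sup (range (fun s => x - atom_tail s x))).
    move=> _ [s _ <-]; apply: sub_tail => // a z.
    have [t ->] := aproj_mult a z; rewrite -[_ *: _]addr0.
    apply: sB.2; last exact: sB.1.
    exact/aB/unit_atomP.
  have [h1 h2] := atom_tail_inf tot x0; split=> [_ [s _ <-]|w wx].
    by rewrite gev_wBr.
  rewrite -subv_ge0 -levN2 oppr0 opprB; apply: h2 => s.
  by rewrite levBlDr addrC -levBlDr; apply: wx; exists s.
have [u [v [u0 v0 ->]]] := pos_decomp y.
by rewrite -scaleN1r addrC; apply: sB.2; exact: Bpos.
Qed.

End Atoms.

(** * Inner band projections *)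

Section Main.
Context {R : realType} {X : banachLatticeType R} (hX : dedekind_complete X).
Implicit Types (x y z w : X) (c t : R).
Local Notation aproj := (aproj hX).
Local Notation atom_tail := (atom_tail hX).
Local Notation unit_atom := (@unit_atom R X).

Lemma bp_Lr_ex (P : bandProj X) : exists2 T : Lr X, 0 <= T & T =1 P.
Proof.
apply: (Lr_ex (M := 1)) => x; first exact: bp_ge0.
by rewrite mul1r; exact: bp_norm_le.
Qed.

(** * Order continuity in terms of atom tails *)

Lemma atom_tail_ge0 s x : 0 <= x -> 0 <= atom_tail s x.
Proof. by have [Q QE] := atom_tail_ex hX s; rewrite -QE; exact: bp_ge0. Qed.

Lemma atom_tail_le s x : 0 <= x -> atom_tail s x <= x.
Proof. by have [Q QE] := atom_tail_ex hX s; rewrite -QE; exact: bp_le. Qed.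

Lemma atom_tail_catl (s t : seq unit_atom) x :
  0 <= x -> atom_tail (s ++ t) x <= atom_tail t x.
Proof. exact: bp_comp_catl vl_generating s t x. Qed.

Lemma atom_tail_catr (s t : seq unit_atom) x :
  0 <= x -> atom_tail (s ++ t) x <= atom_tail s x.
Proof. exact: bp_comp_catr vl_generating s t x. Qed.

Lemma atom_tail_cat (s t : seq unit_atom) x :
  atom_tail (s ++ t) x = atom_tail s (atom_tail t x).
Proof. exact: bp_comp_cat. Qed.

Lemma atom_tail_catC (s t : seq unit_atom) x :
  atom_tail (s ++ t) x = atom_tail t (atom_tail s x).
Proof.
rewrite atom_tail_cat.
have [[P PE] [Q QE]] := (atom_tail_ex hX s, atom_tail_ex hX t).
by rewrite -!PE -!QE bp_comm//; exact: vl_generating.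
Qed.

Lemma posv_tail s x : posv (atom_tail s x) <= posv x.
Proof.
have [Q QE] := atom_tail_ex hX s; rewrite -QE posv_le posv_ge0 andbT.
apply: le_trans (bp_mono Q (le_posv x)) _; apply: bp_le; exact: posv_ge0.
Qed.

Lemma aproj_total y : atoms_total (X := X) ->
  0 <= y -> (forall a, aproj a y = 0) -> y = 0.
Proof. by move=> tot y0 h; apply: tot => // a; exact: aproj_disj (h a). Qed.

Definition tails_vanish := forall x (e : R), 0 <= x -> 0 < e ->
  exists s, `|atom_tail s x| < e.

Lemma order_continuous_tails : atoms_total (X := X) ->
  order_continuous X -> tails_vanish.
Proof.
move=> tot oc x e x0 e0.
(* Comparing lists through their tails makes the net decreasing by definition, whatever the order or
   repetition of the atoms. *)
pose le (s t : seq unit_atom) :=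
  forall y, 0 <= y -> atom_tail t y <= atom_tail s y.
have [||||||s hs] := oc _ le (fun s => atom_tail s x) _ _ _ _ _ _ e e0.
- exact: (inhabits [::]).
- by move=> s y y0.
- by move=> r s t rs st y y0; exact: le_trans (st y y0) (rs y y0).
- move=> s t; exists (s ++ t); split=> y y0.
    exact: atom_tail_catr.
  exact: atom_tail_catl.
- by move=> s t; exact.
- have [i1 i2] := atom_tail_inf hX tot x0.
  split=> [_ [s _ <-]|w wl]; first exact: i1.
  by apply: i2 => s; apply: wl; exists s.
by exists s; apply: hs => y.
Qed.

(** Fix a list whose tail at [u i0] is small; by monotonicity it stays small at later indices. The
    finitely many remaining coordinates tend to zero, since otherwise a positive multiple of an atom
    would be a lower bound of the net. *)
Lemma tails_order_continuous : tails_vanish -> order_continuous X.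
Proof.
move=> tv I le u [i0] le_refl le_trans' le_dir u_mono [u0 u_inf] e e0.
have upos i : 0 <= u i by apply: u0; exists i.
have [s hs] := tv (u i0) (e / 2) (upos i0) (divr_gt0 e0 (ltr0n _ 2)).
have head r : forall d : R, 0 < d ->
    exists i, forall j, le i j -> `|u j - atom_tail r (u j)| < d.
  elim: r => [|a r IH] d d0.
    by exists i0 => j _; rewrite subrr normr0.
  have d2 : 0 < d / 2 by rewrite divr_gt0.
  have [i hi] := IH _ d2.
  have [k hk] : exists k, `|aproj a (u k)| < d / 2.
    apply: contrapT => /forallNP h.
    have : (d / 2) *: uval a <= 0.
      apply: u_inf => _ [k _ <-]; apply: le_trans (bp_le (aproj a) (upos k)).
      rewrite aproj_norm// -subv_ge0 -scalerBl.
      rewrite scalev_ge0 ?unit_atom_ge0// subr_ge0.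
      by rewrite leNgt; apply/negP; exact: h.
    have [a0 _] := unit_atomP a.
    have -> : (0 : X) = (d / 2) *: 0 by rewrite scaler0.
    by rewrite lev_pscale// => /(lt_le_trans a0); rewrite ltxx.
  have [l [il kl]] := le_dir i k.
  exists l => j lj; rewrite atom_tail_cons opprB addrCA addrC.
  apply: le_lt_trans (ler_normD _ _) _; rewrite [d]splitr; apply: ltrD.
    by apply: hi; exact: le_trans' il lj.
  apply: le_lt_trans hk; apply: norm_mono; first exact/bp_ge0/atom_tail_ge0.
  apply: bp_mono; apply: le_trans (atom_tail_le _ (upos j)) _.
  by apply: u_mono; exact: le_trans' kl lj.
have [i hi] := head s _ (divr_gt0 e0 (ltr0n _ 2)).
have [k [i0k ik]] := le_dir i0 i.
exists k => j kj; rewrite -(subrK (atom_tail s (u j)) (u j)).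
apply: le_lt_trans (ler_normD _ _) _; rewrite [e]splitr; apply: ltrD.
  by apply: hi; exact: le_trans' ik kj.
apply: le_lt_trans hs; apply: norm_mono; first exact: atom_tail_ge0.
have [Q QE] := atom_tail_ex hX s; rewrite -!QE bp_mono// u_mono//.
exact: le_trans' i0k kj.
Qed.

(** * Consequences of innerness *)

Lemma multiple_of_comparable (u v : X) : 0 < u -> 0 <= v -> v <= u ->
  (forall c, 0 <= c -> c *: u <= v \/ v <= c *: u) ->
  exists2 c, 0 <= c & v = c *: u.
Proof.
move=> u0 v0 vu tot; pose A := [set c : R | 0 <= c /\ c *: u <= v].
have A0 : A 0 by split=> //; rewrite scale0r.
have nu : 0 < `|u| by rewrite normr_gt0 gt_eqF.
have A1 : ubound A 1.
  move=> c [c0 cu]; rewrite -(ler_pM2r nu) mul1r.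
  rewrite -{1}(ger0_norm c0) -normrZ.
  apply: norm_mono; last exact: le_trans cu vu.
  exact: scalev_ge0 _ _ c0 (ltW u0).
have hs : has_sup A by split; [exists 0|exists 1].
have s0 : 0 <= sup A by exact: sup_ubound hs.2 _ A0.
exists (sup A) => //; apply/le_anti/andP; split;
    apply: (@vl_archimedean _ _ _ _ u) => e e0.
  have nA : ~ A (sup A + e).
    by move=> /(sup_ubound hs.2); rewrite leNgt ltrDl e0.
  rewrite -scalerDl; have se : 0 <= sup A + e by exact: addr_ge0 s0 (ltW e0).
  by have [h|//] := tot _ se; exfalso; apply: nA.
have [c [c0 cv] ce] := sup_adherent e0 hs.
rewrite -levBlDr -scalerBl; apply: le_trans cv.
by rewrite -subv_ge0 -scalerBl scalev_ge0 ?ltW// subr_gt0.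
Qed.

(* Applies innerness to the projection onto the operators commuting with all
   band projections. It fixes the identity, so the diagonal blocks in [G] exhaust
   [X]; on such a block every rank one operator preserves disjointness, so the
   block is one-dimensional. *)
Lemma inner_atoms_total :
  (forall PP : bandProj (Lr X), inner PP) -> atoms_total (X := X).
Proof.
move=> allinner x x0 dx; apply: contrapT => xn0.
have [PP [PPkill PPfix]] := Lr_bp_common_kernel hX
  (fun Q : bandProj X => bp_sandwich (bp_compl Q) Q).
have [I I0 IE] := bp_Lr_ex bp_id.
have PPI : PP I = I.
  apply: PPfix => // Q; apply: val_inj; apply/funext => y /=.
  by rewrite IE /= bp_idem subrr.
have [L [P [G [Pd PG]]]] := allinner PP.
have [h0 h1] := PG I I0.
have [G0|/eqP/set0P G0] := pselect (G = set0).
  by apply: xn0; have := IE x; rewrite -PPI h0.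
have {h0 h1} [_ h1] := h1 G0; rewrite PPI in h1.
have [[a b] Gab /eqP Pab] : exists2 ab, G ab & P ab.1 (P ab.2 x) <> 0.
  apply: contrapT => nex.
  (* If every block of the identity killed [x], all of them would lie below [I - Q]. Then
     [I <= I - Q], and evaluation at [x = Q x] gives [x <= 0]. *)
  have [Q [Qx Q0 Qd _]] := principal_bandProjP hX x0.
  have [U U0 UE] := bp_Lr_ex (bp_compl Q).
  have : I <= U.
    apply: h1 => _ [[a b] Gab <-]; apply/Lr_leP => z z0; rewrite UE /= IE /=.
    pose S := BandProj (comp_band_projection (P a) (P b) vl_generating).
    rewrite -[P a (P b z)]/(S z).
    have Sx : S x = 0.
      by apply: contrapT => Sn0; apply: nex; exists (a, b).
    have QS0 : Q (S z) = 0.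
      rewrite -(bp_idem Q); apply: Q0; first exact/bp_ge0/bp_ge0.
      move=> w wQ wx; apply: le_trans (le_posv w) _.
      have wQ' : posv w <= Q (S z) by rewrite posv_le wQ !bp_ge0.
      have <- : S (posv w) = posv w.
        apply: (bp_id_on (y := Q (S z))); rewrite ?posv_ge0//.
        by rewrite (bp_comm S Q vl_generating) bp_idem.
      by rewrite -Sx bp_mono// posv_le wx x0.
    have := bp_mono (bp_compl Q) (bp_le S z0).
    by rewrite /= QS0 subr0.
  move=> /Lr_leP/(_ x x0); rewrite UE IE /= Qx subrr => xle0.
  by apply: xn0; apply/le_anti; rewrite xle0.
rewrite /= in Pab.
have ab : a = b by apply: contrapT => nab; rewrite Pd// eqxx in Pab.
rewrite -{b}ab bp_idem in Gab Pab.
set u := P a x in Pab.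
have u0 : 0 < u by rewrite lt_def Pab bp_ge0.
have Pu : P a u = u by exact: bp_idem.
(* Take [T] of rank one with [T y = f y *: z] and [f y > 0]. The block [(a, a)] gives
   [f y *: z <= PP T y]; the right side lies in the range of the principal projection of [y],
   whereas [z] is disjoint from it. *)
have small y z : 0 <= y -> 0 <= z -> P a y = y -> P a z = z -> disj z y ->
    y = 0 \/ z = 0.
  move=> y0 z0 Py Pz dzy.
  have [->|yn0] := eqVneq y 0; [by left|right].
  have [f [T [_ fy f0 T0 TE]]] :=
    rank1_ex y sublinear_norm_posv (fun _ => lexx _) z0.
  have [_ /(_ G0)[TG _]] := PG T T0.
  have [Q [Qy Q0 _ _]] := principal_bandProjP hX y0.
  have fy0 : 0 < f y by rewrite fy posv_id// normr_gt0.
  have /Lr_leP/(_ y y0) : sandwich (P a) (P a) T <= PP T.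
    by apply: TG; exists (a, a).
  rewrite /= Py TE linearZ /= Pz => /(bp_mono (bp_compl Q)).
  have /(congr1 (fun S : Lr X => S y)) /= := PPkill Q T.
  rewrite Qy => ->; rewrite linearZ /= Q0// scaler0 subr0 => fz.
  apply/le_anti; rewrite z0 andbT -(lev_pscale _ _ fy0) scaler0.
  exact: fz.
(* For [0 <= v <= u], the two parts of [v - c *: u] are disjoint and fixed by [P a], so one
   vanishes: [v] is comparable with every multiple of [u]. *)
have ua : atom u.
  split=> // v v0 vu; apply: multiple_of_comparable => // c c0.
  have pu w : w <= c *: u \/ w <= v -> P a (posv w) = posv w.
    move=> wle; have [|] := wle => ww.
      apply: (bp_id_on (y := c *: u)); rewrite ?posv_ge0 ?linearZ ?Pu//.
      by rewrite posv_le ww scalev_ge0// ltW.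
    apply: (bp_id_on (y := u)); rewrite ?posv_ge0 ?Pu//.
    by rewrite posv_le (le_trans ww vu) ltW.
  have cu0 : 0 <= c *: u by rewrite scalev_ge0// ltW.
  have [|||p0|p0] := small _ _ (posv_ge0 (v - c *: u)) (posv_ge0 (c *: u - v)).
  - by apply: pu; right; rewrite gev_wBr.
  - by apply: pu; left; rewrite gev_wBr.
  - by have := @posv_disj _ _ (c *: u - v); rewrite opprB.
  - right; rewrite -subv_ge0 -levN2 opprB oppr0 -p0; exact: le_posv.
  - left; rewrite -subv_ge0 -levN2 opprB oppr0 -p0; exact: le_posv.
have [w uw] := unit_atom_of ua.
have ux : u <= x by exact: bp_le.
have : u <= 0.
  by apply: (disj_scale (unit_atom_ge0 w) (dx w) ux (c := `|u|)); rewrite -uw.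
by move=> /(lt_le_trans u0); rewrite ltxx.
Qed.

(* Applies innerness to the projection onto the operators vanishing on the atoms.
   Some [f \otimes x] is fixed by it, with [f] a positive functional below
   [inf_s `|(atom_tail s y)^+|]; but the same block of an operator supported on a
   single atom then also lies in its range. *)
Lemma inner_order_continuous : atoms_total (X := X) ->
  (forall PP : bandProj (Lr X), inner PP) -> order_continuous X.
Proof.
move=> tot allinner; apply: tails_order_continuous => x e x0 e0.
apply: contrapT => /forallNP hs.
pose p y := inf (range (fun s => `|posv (atom_tail s y)|)).
have pb y : bounded_below (fun s => `|posv (atom_tail s y)|) by exists 0 => s.
have sp : sublinear p.
  split=> [y z|c y c0].
    apply: (inf_range_addr [::]) => // s t; exists (s ++ t).
    have [Q QE] := atom_tail_ex hX (s ++ t); rewrite -QE linearD /= !QE.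
    apply: le_trans (norm_mono (posv_ge0 _) (posvD _ _)) _.
    apply: le_trans (ler_normD _ _) _.
    apply: lerD; apply: norm_mono (posv_ge0 _) _.
      by rewrite atom_tail_catC posv_tail.
    by rewrite atom_tail_cat posv_tail.
  apply: (inf_range_scale [::]) => // s; exists s.
  have [Q QE] := atom_tail_ex hX s; rewrite -!QE linearZ /= posvZ//.
  by rewrite normrZ gtr0_norm.
have pn y : p y <= `|posv y| by exact: (inf_range_le [::] (pb y)).
have px : 0 < p x.
  apply: (lt_le_trans e0); apply: (le_inf_range [::]) => s.
  by rewrite posv_id ?atom_tail_ge0// leNgt; apply/negP; exact: hs.
have [f [T [fp fx f0 T0 TE]]] := rank1_ex x sp pn x0.
have fa a y : 0 <= y -> f (aproj a y) = 0.
  move=> y0; apply/le_anti; rewrite f0 ?bp_ge0// andbT.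
  apply: le_trans (fp _) _; apply: le_trans (inf_range_le [:: a] (pb _)) _.
  by rewrite /atom_tail /= /bp_compl /= bp_idem subrr posv_id// normr0.
have xp : 0 < x.
  rewrite lt_def x0 andbT; apply/eqP => x_0; move: px.
  by rewrite -fx x_0 linear0 ltxx.
have [PP [PPkill PPfix]] := Lr_bp_common_kernel hX
  (fun a : unit_atom => bp_sandwich bp_id (aproj a)).
have PPT : PP T = T.
  apply: PPfix => // a; apply: Lr_pos_eq => y y0.
  by rewrite /= TE fa// scale0r.
have Tx : 0 < T x.
  rewrite TE fx lt_def scaler_eq0 !gt_eqF//=; exact: scalev_ge0 (ltW px) x0.
have [L [P [G [Pd PG]]]] := allinner PP.
have [h0 h1] := PG T T0.
have [G0|/eqP/set0P G0] := pselect (G = set0).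
  by move: Tx; rewrite -PPT h0// ltxx.
have {h0 h1} [_ h1] := h1 G0; rewrite PPT in h1.
have [[a b] Gab [y y0 yP]] : exists2 ab, G ab &
    exists2 y, 0 <= y & P ab.1 (T (P ab.2 y)) <> 0.
  apply: contrapT => nex; have /Lr_leP/(_ _ x0) : T <= 0.
    apply: h1 => _ [[a b] Gab <-]; apply/Lr_leP => y y0 /=.
    rewrite [leLHS](_ : _ = 0)//; apply: contrapT => h; apply: nex.
    by exists (a, b) => //; exists y.
  by move=> /(lt_le_trans Tx); rewrite ltxx.
rewrite /= in yP.
have Py0 : P b y <> 0 by move=> Py; apply: yP; rewrite Py !linear0.
have Px0 : P a x <> 0 by move=> Px; apply: yP; rewrite TE linearZ /= Px scaler0.
have [d dPy] : exists d, aproj d (P b y) <> 0.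
  apply: contrapT => /forallNP h; apply: Py0.
  by apply: (aproj_total tot) => [|d]; [exact: bp_ge0|exact: contrapT (h d)].
set v := aproj d (P b y) in dPy.
have v0 : 0 <= v by rewrite !bp_ge0.
(* The range is again spanned by [x], because [P a x] is known to be nonzero; [g] is chosen positive
   at [v], a nonzero multiple of an atom. *)
have [g [S [_ gv g0 S0 SE]]] :=
  rank1_ex v sublinear_norm_posv (fun _ => lexx _) x0.
pose S' := sandwich bp_id (aproj d) S.
have S'0 : 0 <= S' by exact: sandwich_ge0.
have [_ /(_ G0)[SG _]] := PG S' S'0.
have /Lr_leP/(_ _ y0) : sandwich (P a) (P b) S' <= PP S'.
  by apply: SG; exists (a, b).
(* [PP S'] vanishes on the range of [aproj d], and on the complement it is dominated by [S'], which
   is zero there. *)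
have PS0 : PP S' <= 0.
  apply/Lr_leP => z z0.
  have /(congr1 (fun U : Lr X => U z)) /= PPz := PPkill d S'.
  rewrite -(subrK (aproj d z) z) linearD /= PPz addr0.
  have zc0 : 0 <= z - aproj d z := bp_ge0 (bp_compl (aproj d)) z0.
  apply: le_trans ((Lr_leP _ _ (bp_le PP S'0)) _ zc0) _.
  by rewrite /= linearB /= bp_idem subrr linear0.
have PS0y : PP S' y <= 0 := Lr_leP _ _ PS0 _ y0.
move=> /le_trans/(_ PS0y); rewrite /= SE linearZ /=.
have gv0 : 0 < g v by rewrite gv posv_id// normr_gt0; exact/eqP.
have -> : (0 : X) = g v *: 0 by rewrite scaler0.
rewrite lev_pscale// => Pax; apply: Px0; apply/le_anti.
by rewrite Pax bp_ge0.
Qed.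

(** * Operators determined by their atomic blocks *)

Lemma unit_atom_inj : injective (@uval R X).
Proof. by move=> [a ha] [b hb] /= ab; exact: eq_exist. Qed.

(** A nonzero [aproj a (uval b)] would be a multiple of both unit atoms, with its norm as
    coefficient in each case. *)
Lemma aproj_disjoint (a b : unit_atom) x : a <> b -> aproj a (aproj b x) = 0.
Proof.
move=> nab; have [t ->] := aproj_mult hX b x; rewrite linearZ /=.
suff -> : aproj a (uval b) = 0 by rewrite scaler0.
have b0 := unit_atom_ge0 b; have ab := aproj_norm hX a b0.
have [d d0 dE] := (unit_atomP b).2 _ (bp_ge0 (aproj a) b0) (bp_le (aproj a) b0).
apply: contrapT => /eqP abn0; apply: nab; apply: unit_atom_inj.
have nd : `|aproj a (uval b)| = d.
  by rewrite dE normrZ unit_atom_norm mulr1 ger0_norm.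
have dn : d != 0 by rewrite -nd normr_eq0.
by apply: (scalerI dn); rewrite -dE -nd -ab.
Qed.

(** Totality on the target side gives positivity on each atom, addition extends it to
    [x - atom_tail s x], and boundedness of [S] with closedness of the cone reaches [x]. *)
Lemma aproj_positive (S : Lr X) : atoms_total (X := X) -> tails_vanish ->
  (forall a b, 0 <= sandwich (aproj a) (aproj b) S) -> 0 <= S.
Proof.
move=> tot tv S0.
have Sb b z : 0 <= z -> 0 <= S (aproj b z).
  move=> z0; set v := S (aproj b z).
  have : posv (- v) = 0.
    apply: aproj_total => //; first exact: posv_ge0.
    move=> a; apply: bp_posv_le0; rewrite linearN -levN2 opprK oppr0.
    exact: (Lr_ge0P _ (S0 a b)).
  by rewrite -levN2 oppr0 => <-; exact: le_posv.
have St s x : 0 <= x -> 0 <= S (x - atom_tail s x).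
  move=> x0; elim: s => [|b s IH]; first by rewrite subrr linear0.
  by rewrite atom_tail_cons opprB addrCA linearD addv_ge0 ?Sb// atom_tail_ge0.
apply/Lr_ge0P => x x0; apply: cone_closed => e e0.
have [M M0 SM] := Lr_bounded S.
have [s hs] := tv x (e / M) x0 (divr_gt0 e0 M0).
exists (S (x - atom_tail s x)); first exact: St.
rewrite linearB addrAC subrr add0r normrN.
by apply: le_lt_trans (SM _) _; rewrite mulrC -ltr_pdivlMr.
Qed.

Lemma aproj_sandwich_multiple (a b : unit_atom) (S T : Lr X) :
  sandwich (aproj a) (aproj b) S <> 0 ->
  exists c,
    sandwich (aproj a) (aproj b) T = c *: sandwich (aproj a) (aproj b) S.
Proof.
move=> Sn0; have [s sE] := aproj_mult hX a (S (uval b)).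
have [t tE] := aproj_mult hX a (T (uval b)).
have s0 : s != 0.
  apply/eqP => s0; apply: Sn0; apply: Lr_pos_eq => x x0 /=.
  by have [r ->] := aproj_mult hX b x; rewrite !linearZ /= sE s0 scale0r scaler0.
exists (t / s); apply: Lr_pos_eq => x x0; rewrite LrZ /=.
have [r ->] := aproj_mult hX b x; rewrite !linearZ /= sE tE !scalerA.
by congr (_ *: _); rewrite -mulrA divfK.
Qed.

Lemma all_inner : atoms_total (X := X) -> order_continuous X ->
  forall PP : bandProj (Lr X), inner PP.
Proof.
move=> tot /(order_continuous_tails tot) tv PP.
pose E (ab : unit_atom * unit_atom) := sandwich (aproj ab.1) (aproj ab.2).
pose G := [set ab | forall T, PP (E ab T) = E ab T].
(* The block of [PP T] lies between [0] and [PP T], so [PP] fixes it. Were it nonzero, every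
   operator would have a multiple of it as its block at [ab], putting [ab] in [G]. *)
have notG ab T : ~ G ab -> 0 <= T -> E ab (PP T) = 0.
  move=> nG T0; apply: contrapT => En0; apply: nG => S.
  have [c] := aproj_sandwich_multiple S En0.
  rewrite -!/(E _ _) => ->; rewrite linearZ /=; congr (_ *: _).
  have PPT0 := bp_ge0 PP T0.
  apply: (bp_id_on (y := PP T)).
  - exact: sandwich_ge0.
  - exact: sandwich_le.
  - exact: bp_idem.
exists unit_atom, aproj, G; split=> [a b ab x|T T0].
  exact: aproj_disjoint.
have PPT0 := bp_ge0 PP T0.
split=> [G0|[ab0 Gab0]].
  apply/le_anti; rewrite PPT0 andbT -levN2 oppr0.
  apply: aproj_positive => // a b; rewrite linearN /=.
  by rewrite [sandwich _ _ _](notG (a, b))// ?oppr0// G0.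
split=> [_ [ab Gab <-]|U Uub].
  rewrite -[sandwich _ _ _]/(E ab T) -(Gab T).
  by apply: bp_mono; exact: sandwich_le.
have U0 : 0 <= U.
  by apply: le_trans (Uub _ (imageP _ Gab0)); exact: sandwich_ge0.
rewrite -subv_ge0; apply: aproj_positive => // a b.
rewrite linearB /= subv_ge0; have [Gab|nG] := pselect (G (a, b)); last first.
  by rewrite [X in X <= _](notG (a, b))//; exact: sandwich_ge0.
pose Pab := bp_sandwich (aproj a) (aproj b).
(* Only the block of [T], not [T] itself, is known to lie below [U]; idempotence supplies the second
   application of [Pab]. *)
apply: le_trans (bp_mono Pab (bp_le PP T0)) _; rewrite -bp_idem.
exact: bp_mono (Uub _ (imageP _ Gab)).
Qed.

End Main.

Theorem theorem3p1 (R : realType) (X : banachLatticeType R)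
    (hX : dedekind_complete X) :
  (forall PP : bandProj (Lr X), inner PP) <->
  (atomic X /\ order_continuous X).
Proof.
split=> [allinner|[/(atomicP hX) tot oc]]; last exact: all_inner.
have tot := inner_atoms_total hX allinner.
by split; [exact/(atomicP hX)|exact: inner_order_continuous].
Qed.
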